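(* Let $(F,E,L)$ be a $\sigma$-admissible triple, $\Phi\in\mathrm{GL}_r(E)$, $\Psi\in\mathrm{GL}_r(L)$ with $\sigma(\Psi)=\Phi\Psi$, and $Z,Z_l,\Gamma,\Gamma_m$ as in the context. Then: (1) $\Gamma$ is a closed $F$-subgroup scheme of $\mathrm{GL}_{r/F}$, and $Z$ is stable under right multiplication by $\Gamma_E$ and is a $\Gamma_E$-torsor; (2) $\Gamma_0$ is a closed $F$-subgroup scheme of $\mathrm{GL}_{r/F}$, and for each $l$, $Z_l$ is stable under right multiplication by $\Gamma_{0,E}$ and is a $\Gamma_{0,E}$-torsor; (3) for each $m$, $\Gamma_m$ is stable under right and left multiplication by $\Gamma_0$ and is a $\Gamma_0$-torsor.
   Context: A $\sigma$-admissible triple $(F,E,L)$ consists of a positive integer $d$, rings $F\subset E\subset L$ with $F,E$ fields and $L=\prod_{l\in\mathbb{Z}/d}L_l$ a finite product of fields, and a ring endomorphism $\sigma:L\to L$ with $\sigma(E)\subset E$, $\sigma(L_l)\subset L_{l+1}$, $F=E^\sigma=L^\sigma$, and $L$ separable over $E$; $\sigma$ acts on matrices entrywise. Write $\Psi_{ij}=(\Psi_{ijl})_l$, $\Psi_l:=(\Psi_{ijl})\in\mathrm{GL}_r(L_l)$. Let $X=(X_{ij})$ be indeterminates, $\Delta=\det X$. $Z:=\mathrm{Spec}\,E[X,\Delta^{-1}]/\mathfrak p$ and $Z_l:=\mathrm{Spec}\,E[X,\Delta^{-1}]/\mathfrak p_l$, where $\mathfrak p,\mathfrak p_l$ are the kernels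 of $X\mapsto\Psi\in\mathrm{GL}_r(L)$ and $X\mapsto\Psi_l\in\mathrm{GL}_r(L_l)$ (closed subschemes of $\mathrm{GL}_{r/E}$). With $\Psi_1=(\Psi_{ij}\otimes1)$, $\Psi_2=(1\otimes\Psi_{ij})$ in $\mathrm{GL}_r(L\otimes_EL)$ and $\Psi_1^{-1}\Psi_2=(\widetilde\Psi_{ij})$, $\widetilde\Psi_{ij}=(\widetilde\Psi_{ijlm})_{l,m}\in\prod_{l,m}L_l\otimes_EL_m$: $\Gamma:=\mathrm{Spec}\,F[X,\Delta^{-1}]/\mathfrak q$ with $\mathfrak q=\ker(X\mapsto\Psi_1^{-1}\Psi_2)$, and $\Gamma_m:=\mathrm{Spec}\,F[X,\Delta^{-1}]/\mathfrak q_m$ with $\mathfrak q_m$ the kernel of $F[X,\Delta^{-1}]\to L_0\otimes_EL_m$, $X_{ij}\mapsto\widetilde\Psi_{ij0m}$; these are closed subschemes of $\mathrm{GL}_{r/F}$. Base change to $E$ is denoted by a subscript $E$. *)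

(* Defs.v *)
From HB Require Import structures.
From mathcomp Require Import all_boot all_order all_algebra.
From mathcomp Require Import finmap generic_quotient ring_quotient.
From mathcomp Require boolp classical_sets.
From mathcomp.multinomials Require monalg mpoly.

Set Implicit Arguments.
Unset Strict Implicit.
Unset Printing Implicit Defensive.

Import GRing.Theory.
Local Open Scope ring_scope.
Local Open Scope quotient_scope.

Definition is_ideal (A : comNzRingType) (I : A -> Prop) : Prop :=
  [/\ I 0, (forall x y, I x -> I y -> I (x + y)) & (forall a x, I x -> I (a * x))].

Definition ideal_gen (A : comNzRingType) (S : A -> Prop) (x : A) : Prop :=
  forall I : A -> Prop, is_ideal I -> (forall y, S y -> I y) -> I x.

Lemma ideal_gen_sub (A : comNzRingType) (S : A -> Prop) (x : A) :
  S x -> ideal_gen S x.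
Proof. by move=> Sx I _; apply. Qed.

Lemma ideal_gen_is_ideal (A : comNzRingType) (S : A -> Prop) :
  is_ideal (ideal_gen S).
Proof.
split=> [I [] //|x y Sx Sy I II SI|a x Sx I II SI].
- by have [_ + _] := II; apply; [apply: Sx|apply: Sy].
- by have [_ _ +] := II; apply; apply: Sx.
Qed.

Lemma ker_is_ideal (A B : comNzRingType) (f : {rmorphism A -> B}) :
  is_ideal (fun x => f x = 0).
Proof.
split; first exact: rmorph0.
- by move=> x y fx fy; rewrite rmorphD fx fy addr0.
- by move=> a x fx; rewrite rmorphM fx mulr0.
Qed.

Lemma ideal_gen_functional (A : comNzRingType) (V : zmodType) (lam : A -> V)
    (S : A -> Prop) (x : A) :
  {morph lam : y z / y + z} -> lam 0 = 0 ->
  ideal_gen S x -> (forall y, S y -> forall f, lam (f * y) = 0) -> lam x = 0.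
Proof.
move=> lamD lam0 Sx SI; rewrite -[x]mul1r.
apply: (Sx (fun y => forall f, lam (f * y) = 0)) => //.
split=> [f|y z Iy Iz f|a y Iy f]; first by rewrite mulr0.
- by rewrite mulrDr lamD Iy Iz addr0.
- by rewrite mulrA Iy.
Qed.

Lemma unital_functional (E : fieldType) (M : comNzRingType)
    (i : {rmorphism E -> M}) :
  exists psi : M -> E, [/\ {morph psi : x y / x + y},
    (forall e x, psi (i e * x) = e * psi x) & psi 1 = 1].
Proof.
pose sub (V : M -> Prop) := [/\ V 0, (forall x y, V x -> V y -> V (x + y)) &
  (forall e x, V x -> V (i e * x))].
pose P (V : M -> Prop) := (forall x, V x -> x = 0) \/ (sub V /\ ~ V 1).
have [V [PV maxV]] : exists V, P V /\
    forall B : M -> Prop, classical_sets.proper V B -> ~ P B.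
  apply: (@classical_sets.Zorn_bigcup M P) => F FP Ftot.
  have [[X [FX [x [Xx x0]]]]|triv] :=
      boolp.EM (exists X, F X /\ exists x, X x /\ x <> 0); last first.
    left=> x [X FX Xx]; apply: boolp.contrapT => x0; apply: triv.
    by exists X; split=> //; exists x.
  have good Y : F Y -> classical_sets.subset X Y -> sub Y /\ ~ Y 1.
    move=> FY XY; have [Y0|//] : P Y := FP _ FY.
    by case: x0; apply: Y0; apply: XY.
  have up Y : F Y -> exists Z,
      [/\ F Z, classical_sets.subset X Z & classical_sets.subset Y Z].
    by move=> FY; case: (Ftot _ _ FX FY) => h; [exists Y|exists X]; split=> // z.
  right; split; last first.
    move=> [Y FY Y1]; have [Z [FZ XZ YZ]] := up _ FY.
    by have [_] := good _ FZ XZ; apply; apply: YZ.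
  split.
  - by exists X => //; have [[]] := good _ FX (fun _ => id).
  - move=> y z [Y FY Yy] [Z FZ Zz].
    have [Y' [FY' XY' YY']] := up _ FY; have [Z' [FZ' XZ' ZZ']] := up _ FZ.
    have [h|h] := Ftot _ _ FY' FZ'.
    + by exists Z' => //; have [[_ + _] _] := good _ FZ' XZ'; apply;
        [apply: h; apply: YY'|apply: ZZ'].
    + by exists Y' => //; have [[_ + _] _] := good _ FY' XY'; apply;
        [apply: YY'|apply: h; apply: ZZ'].
  - move=> e y [Y FY Yy]; have [Y' [FY' XY' YY']] := up _ FY.
    by exists Y' => //; have [[_ _ +] _] := good _ FY' XY'; apply; apply: YY'.
have key (B : M -> Prop) : classical_sets.subset V B ->
    sub B -> ~ B 1 -> forall x, B x -> V x.
  move=> VB sB B1 x Bx; apply: boolp.contrapT => Vx.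
  by apply: (maxV B); [split=> // BV; apply: Vx; apply: BV|right].
have [sV V1] : sub V /\ ~ V 1.
  case: PV => // V0.
  have s0 : sub (fun x => x = 0).
    by split=> // [x y -> ->|e x ->]; rewrite ?addr0 ?mulr0.
  have n1 : (1 : M) <> 0 by apply/eqP/oner_neq0.
  have VE : V = (fun x => x = 0).
    apply/boolp.funext => x; apply/boolp.propext; split; first exact: V0.
    exact: (key _ V0 s0 n1).
  by rewrite VE.
have [V0 VD VZ] := sV.
have VN x : V x -> V (- x).
  by move=> /(VZ (-1)); rewrite rmorphN1 mulN1r.
have dec x : exists e, V (x - i e).
  have [Vx|Vx] := boolp.EM (V x); first by exists 0; rewrite rmorph0 subr0.
  pose B y := exists v e, V v /\ y = v + i e * x.
  have VB : classical_sets.subset V B.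
    by move=> v Vv; exists v, 0; rewrite rmorph0 mul0r addr0.
  have sB : sub B.
    split; first exact: VB.
    - move=> _ _ [v [e [Vv ->]]] [w [f [Vw ->]]]; exists (v + w), (e + f).
      by split; [exact: VD|rewrite rmorphD mulrDl addrACA].
    - move=> f _ [v [e [Vv ->]]]; exists (i f * v), (f * e).
      by split; [exact: VZ|rewrite rmorphM mulrDr mulrA].
  have Bx : B x by exists 0, 1; rewrite rmorph1 mul1r add0r.
  have [[v [e [Vv E1]]]|B1] := boolp.EM (B 1); last first.
    by case: Vx; apply: (key B).
  have e0 : e != 0.
    by apply/eqP => e0; apply: V1; rewrite E1 e0 rmorph0 mul0r addr0.
  exists e^-1; have -> : x - i e^-1 = i (- e^-1) * v.
    have -> : v = 1 - i e * x by rewrite E1 addrK.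
    rewrite rmorphN mulNr mulrBr mulr1 mulrA -rmorphM mulVf // rmorph1 mul1r.
    by rewrite opprB.
  exact: VZ.
have uniq x e f : V (x - i e) -> V (x - i f) -> e = f.
  move=> Ve Vf; apply: boolp.contrapT => ef; apply: V1.
  have d0 : f - e != 0 by rewrite subr_eq0 eq_sym; apply/eqP.
  have := VZ (f - e)^-1 _ (VD _ _ (VN _ Vf) Ve).
  by rewrite opprB addrA subrK -rmorphB -rmorphM mulVf ?rmorph1.
pose psi x := sval (boolp.cid (dec x)).
have psiP x : V (x - i (psi x)) by rewrite /psi; case: boolp.cid.
exists psi; split.
- move=> x y; apply: (uniq (x + y)) => //.
  by rewrite rmorphD opprD addrACA; apply: VD.
- move=> e x; apply: (uniq (i e * x)) => //.
  by rewrite rmorphM -mulrBr; apply: VZ.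
- by apply: (uniq 1) => //; rewrite rmorph1 subrr.
Qed.

Module PolyRing.
Import monalg.

Section MonomialEval.
Context (I : choiceType) (S : comNzRingType) (x : I -> S).

Definition cmeval (m : cmonom I) : S := \prod_(i <- finsupp m) x i ^+ m i.

Lemma cmevalEw (m : cmonom I) (d : {fset I}) :
  (finsupp m `<=` d)%fset -> cmeval m = \prod_(i <- d) x i ^+ m i.
Proof.
move=> le; rewrite /cmeval (big_fset_incl _ le) // => i _.
by rewrite -cmE_neq0 negbK => /eqP ->; rewrite expr0.
Qed.

Lemma cmeval_mmorphism : mmorphism cmeval.
Proof.
split=> [m1 m2|]; last by rewrite /cmeval mdom1 big_seq_fset0.
rewrite /cmeval mdomD -/(cmeval m1) -/(cmeval m2).
rewrite (cmevalEw (fsubsetUl _ (finsupp m2))).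
rewrite (cmevalEw (fsubsetUr (finsupp m1) _)) -big_split /=.
by apply: eq_bigr => i _; rewrite cmM exprD.
Qed.

HB.instance Definition _ :=
  isMultiplicative.Build (cmonom I) S cmeval cmeval_mmorphism.

Lemma cmevalU (i : I) : cmeval (ucm i) = x i.
Proof. by rewrite /cmeval mdomU big_seq_fset1 cmUU expr1. Qed.

End MonomialEval.

Lemma polyring_monomials (M : comNzRingType) : exists h : cmonom M -> M,
  h mone = 1 /\ forall k m, h (mmul k (ucm m)) = h k * m.
Proof.
have [hM h1] := @cmeval_mmorphism M M id.
by exists (cmeval id); split=> // k m; rewrite hM cmevalU.
Qed.

Module Impl.
Definition polyring (L : comNzRingType) (I : choiceType) : Type :=
 {malg L[cmonom I]}.
HB.instance Definition _ (L : comNzRingType) (I : choiceType) :=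
  GRing.ComNzRing.on (polyring L I).

HB.lock Definition pC (L : comNzRingType) (I : choiceType) (c : L) :
  polyring L I := @malgC (cmonom I) L c.
HB.lock Definition pM (L : comNzRingType) (I : choiceType)
  (k : cmonom I) : polyring L I := << k >>.
HB.lock Definition pev (L : comNzRingType) (I : choiceType)
  (R : comNzRingType) (f : L -> R) (g : I -> R) (p : polyring L I) : R :=
  mmap f (cmeval g) p.

Section Theory.
Context (L : comNzRingType) (I : choiceType).
Local Notation polyring := (polyring L I).
Local Notation pC := (@pC L I).
Local Notation pM := (@pM L I).

Let pCE c : pC c = (c%:MP : {malg L[cmonom I]}).
Proof. by rewrite pC.unlock. Qed.
Let pME k : pM k = (<< k >> : {malg L[cmonom I]}).
Proof. by rewrite pM.unlock. Qed.

Lemma pC_zmod_morphism : zmod_morphism pC.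
Proof. by move=> x y; rewrite !pCE; exact: (raddfB (@malgC (cmonom I) L)). Qed.

Lemma pC_monoid_morphism : monoid_morphism pC.
Proof.
by split=> [|x y]; rewrite !pCE //; exact: (rmorphM (@malgC (cmonom I) L)).
Qed.

HB.instance Definition _ :=
  GRing.isZmodMorphism.Build L polyring pC pC_zmod_morphism.
HB.instance Definition _ :=
  GRing.isMonoidMorphism.Build L polyring pC pC_monoid_morphism.

Lemma pM1 : pM mone = 1. Proof. by rewrite pME. Qed.

Let pCM c k : pC c * pM k = (<< c *g k >> : {malg L[cmonom I]}).
Proof. by rewrite pCE pME [LHS](@fgmulUU (cmonom I) L) mulr1 mul1m. Qed.

Lemma pMM k l : pM (mmul k l) = pM k * pM l.
Proof. by rewrite !pME [RHS](@fgmulUU (cmonom I) L) mulr1. Qed.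

Lemma polyringE (p : polyring) :
  exists (s : seq (cmonom I)) (c : cmonom I -> L), p = \sum_(k <- s) pC (c k) * pM k.
Proof.
exists (msupp (p : {malg L[cmonom I]})), (fun k => mcoeff k p).
by rewrite {1}[p]monalgE; apply: eq_bigr => k _; rewrite pCM.
Qed.

Lemma polyring_functional (h : cmonom I -> L) : exists lam : polyring -> L,
  [/\ {morph lam : x y / x + y}, lam 0 = 0 &
      forall c k, lam (pC c * pM k) = c * h k].
Proof.
exists (mmap (idfun : {additive L -> L}) h).
split=> [x y||c k]; [exact: mmapD|exact: mmap0|].
by rewrite pCM; exact: (@mmapU _ _ _ (idfun : {additive L -> L})).
Qed.

Section Eval.
Context (R : comNzRingType) (f : {rmorphism L -> R}) (g : I -> R).

Local Notation pev := (@pev L I R f g).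

Let pevE p : pev p = mmap f (cmeval g) (p : {malg L[cmonom I]}).
Proof. by rewrite pev.unlock. Qed.

Lemma pev_zmod_morphism : zmod_morphism pev.
Proof. by move=> x y; rewrite !pevE; exact: (@mmap_is_additive _ _ _ f (cmeval g)). Qed.

Lemma pev_monoid_morphism : monoid_morphism pev.
Proof.
have [h1 h2] := @mmap_is_multiplicative (cmonom I) L R f (cmeval g).
by split=> [|x y]; rewrite !pevE; [exact: h2|exact: h1].
Qed.

HB.instance Definition _ :=
  GRing.isZmodMorphism.Build polyring R pev pev_zmod_morphism.
HB.instance Definition _ :=
  GRing.isMonoidMorphism.Build polyring R pev pev_monoid_morphism.

Lemma pevC c : pev (pC c) = f c.
Proof. by rewrite pevE pCE; exact: (@mmapC (cmonom I) L R f (cmeval g)). Qed.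

Lemma pevX i : pev (pM (ucm i)) = g i.
Proof.
transitivity (f 1 * cmeval g (ucm i)).
  by rewrite pevE pME; exact: (@mmapU (cmonom I) L R f (cmeval g)).
by rewrite rmorph1 mul1r cmevalU.
Qed.

End Eval.

End Theory.
End Impl.
Import Impl.


(** The polynomial ring [L[X_i : i in I]] with the properties used below.  It is
    locked: unification must not unfold finitely supported functions. *)
Record polyring (L : comNzRingType) (I : choiceType) := PolyRing {
  polyring_sort :> comNzRingType;
  pC : {rmorphism L -> polyring_sort};
  pM : cmonom I -> polyring_sort;
  pM1 : pM mone = 1;
  pMM : forall k l, pM (mmul k l) = pM k * pM l;
  polyringE : forall p : polyring_sort,
    exists (s : seq (cmonom I)) (c : cmonom I -> L),
      p = \sum_(k <- s) pC (c k) * pM k;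
  polyring_functional : forall h : cmonom I -> L,
    exists lam : polyring_sort -> L, [/\ {morph lam : x y / x + y}, lam 0 = 0 &
      forall c k, lam (pC c * pM k) = c * h k];
  pev : forall R : comNzRingType, {rmorphism L -> R} -> (I -> R) ->
    {rmorphism polyring_sort -> R};
  pevC : forall (R : comNzRingType) (f : {rmorphism L -> R}) (g : I -> R) c,
    pev f g (pC c) = f c;
  pevX : forall (R : comNzRingType) (f : {rmorphism L -> R}) (g : I -> R) i,
    pev f g (pM (ucm i)) = g i;
}.

HB.lock Definition freepoly (L : comNzRingType) (I : choiceType) : polyring L I :=
  @PolyRing L I (Impl.polyring L I) (@Impl.pC L I) (@Impl.pM L I)
    (@Impl.pM1 L I) (@Impl.pMM L I) (@Impl.polyringE L I)
    (@Impl.polyring_functional L I) (@Impl.pev L I) (@Impl.pevC L I)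
    (@Impl.pevX L I).

Definition pX (L : comNzRingType) (I : choiceType) (i : I) : freepoly L I :=
  pM (freepoly L I) (ucm i).

Lemma freepoly_ext (L : comNzRingType) (I : choiceType) (R : comNzRingType)
    (u v : {rmorphism freepoly L I -> R}) :
  (forall c, u (pC _ c) = v (pC _ c)) -> (forall i, u (pX L i) = v (pX L i)) ->
  u =1 v.
Proof.
move=> uvC uvX p; have [s [c ->]] := polyringE p.
rewrite (rmorph_sum u) (rmorph_sum v); apply: eq_bigr => k _.
rewrite (rmorphM u) (rmorphM v) uvC; congr (_ * _).
have [n] := ubnP (mdeg k); elim: n k => // n IH k; rewrite ltnS => kn.
have [k1|[i ik]] := fset_0Vmem (finsupp k).
  suff -> : k = mone by rewrite pM1 (rmorph1 u) (rmorph1 v).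
  by apply: mdeg_eq0I; rewrite mdegE k1 big_seq_fset0.
have ke : k = mmul (ucm i) (divcm k (ucm i)).
  apply/eqP/cmP => j; rewrite cmM cmU divcmE cmU subnKC //.
  by case: eqVneq => // <-; rewrite lt0n cmE_neq0.
rewrite ke pMM (rmorphM u) (rmorphM v) uvX IH //.
by apply: leq_trans kn; rewrite {2}ke mdegM mdegU.
Qed.

End PolyRing.
Export PolyRing.

Section Tensor.
Context (E : fieldType) (L M : comNzRingType).
Context (iL : {rmorphism E -> L}) (iM : {rmorphism E -> M}).

(** [L ⊗_E M] is the polynomial ring over [L] in one variable for each
    [m : M], modulo the relations making [m |-> pX m] a morphism of
    [E]-algebras; see [tens_lift1], [tens_lift2] and [tens_ext] for the
    universal property. *)
Local Notation P := (freepoly L M).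
Local Notation X := (@pX L M).
Local Notation C := (pC (freepoly L M)).

Inductive tens_rel : P -> Prop :=
| TensAdd m n : tens_rel (X (m + n) - (X m + X n))
| TensMul m n : tens_rel (X (m * n) - X m * X n)
| TensBase e : tens_rel (X (iM e) - C (iL e)).

Definition tens_ideal : pred P := fun p => boolp.asbool (ideal_gen tens_rel p).

Lemma tens_idealP (p : P) : reflect (ideal_gen tens_rel p) (p \in tens_ideal).
Proof. exact: boolp.asboolP. Qed.

Lemma tens_ideal_proper : ~ ideal_gen tens_rel 1.
Proof.
have [psi [psiD psiZ psi1]] := unital_functional iM.
have [h [h1 hX]] := polyring_monomials M.
have [lam [lamD lam0 lamE]] := polyring_functional (freepoly L M) (fun k => iL (psi (h k))).
have lamN x : lam (- x) = - lam x.
  by apply/eqP; rewrite -addr_eq0 -lamD addNr lam0.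
have lamX c k m : lam (C c * pM (freepoly L M) k * X m) = c * iL (psi (h k * m)).
  by rewrite -mulrA -pMM lamE hX.
move=> /(ideal_gen_functional lamD lam0) H.
suff: lam 1 = 0.
  rewrite -(mulr1 1) -{1}(rmorph1 C) -(pM1 (freepoly L M)) lamE h1 psi1 rmorph1 mulr1.
  by apply/eqP/oner_neq0.
apply: H => y Sy f; have [s [c ->]] := polyringE f.
rewrite mulr_suml; apply: (big_ind (fun z => lam z = 0)) => // [x z hx hz|k _].
  by rewrite lamD hx hz addr0.
case: Sy => [m n|m n|e].
- rewrite mulrBr mulrDr lamD lamN lamD !lamX mulrDr psiD rmorphD mulrDr.
  by rewrite subrr.
- rewrite mulrBr mulrA lamD lamN lamX.
  by rewrite -[_ * _ * X m]mulrA -pMM lamX hX mulrA subrr.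
- rewrite mulrBr lamD lamN lamX [_ * iM e]mulrC psiZ rmorphM.
  by rewrite [_ * C (iL e)]mulrAC -(rmorphM C) lamE mulrA subrr.
Qed.

Lemma tens_ideal_closed : idealr_closed tens_ideal.
Proof.
have [I0 ID IZ] := ideal_gen_is_ideal tens_rel.
split; first exact/tens_idealP.
  by apply/tens_idealP; apply: tens_ideal_proper.
move=> a x y /tens_idealP Ix /tens_idealP Iy.
by apply/tens_idealP; apply: (ID _ _ (IZ a _ Ix) Iy).
Qed.

HB.instance Definition _ := isIdealr.Build P tens_ideal tens_ideal_closed.

Definition tens_idealr : idealr P := tens_ideal.

Definition tens : Type := {ideal_quot tens_idealr}.
HB.instance Definition _ := GRing.ComNzRing.on tens.

Definition tens_pi (p : P) : tens := \pi_{ideal_quot tens_idealr} p.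

Lemma tens_pi_zmod_morphism : zmod_morphism tens_pi.
Proof. exact: rmorphB. Qed.

Lemma tens_pi_monoid_morphism : monoid_morphism tens_pi.
Proof. by split; [exact: rmorph1|exact: rmorphM]. Qed.

HB.instance Definition _ :=
  GRing.isZmodMorphism.Build P tens tens_pi tens_pi_zmod_morphism.
HB.instance Definition _ :=
  GRing.isMonoidMorphism.Build P tens tens_pi tens_pi_monoid_morphism.

Lemma tens_piP (p q : P) : ideal_gen tens_rel (p - q) <-> tens_pi p = tens_pi q.
Proof.
rewrite /tens_pi; split=> [pq|/eqP].
  by apply/eqP; rewrite -Quotient.idealrBE; apply/tens_idealP.
by rewrite -Quotient.idealrBE => /tens_idealP.
Qed.

Lemma tens_pi_surj (t : tens) : exists p, t = tens_pi p.
Proof. by exists (repr t); rewrite /tens_pi reprK. Qed.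

Definition tens1 (x : L) : tens := tens_pi (C x).
Definition tens2 (m : M) : tens := tens_pi (X m).

Lemma tens1_zmod_morphism : zmod_morphism tens1.
Proof. by move=> x y; rewrite /tens1 !rmorphB. Qed.

Lemma tens1_monoid_morphism : monoid_morphism tens1.
Proof. by split=> [|x y]; rewrite /tens1 ?rmorph1 // !rmorphM. Qed.

HB.instance Definition _ :=
  GRing.isZmodMorphism.Build L tens tens1 tens1_zmod_morphism.
HB.instance Definition _ :=
  GRing.isMonoidMorphism.Build L tens tens1 tens1_monoid_morphism.

Lemma tens12 e : tens1 (iL e) = tens2 (iM e).
Proof. apply: esym; apply: (tens_piP _ _).1; apply: ideal_gen_sub; exact: TensBase. Qed.

Lemma tens2D x y : tens2 (x + y) = tens2 x + tens2 y.
Proof.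
rewrite /tens2 -(rmorphD tens_pi).
apply: (tens_piP _ _).1; apply: ideal_gen_sub; exact: TensAdd.
Qed.

Lemma tens2_zmod_morphism : zmod_morphism tens2.
Proof.
by move=> x y; apply: (addIr (tens2 y)); rewrite -tens2D !subrK.
Qed.

Lemma tens2_monoid_morphism : monoid_morphism tens2.
Proof.
split=> [|x y].
  by rewrite -(rmorph1 iM) -tens12 (rmorph1 iL) (rmorph1 tens1).
rewrite /tens2 -(rmorphM tens_pi).
apply: (tens_piP _ _).1; apply: ideal_gen_sub; exact: TensMul.
Qed.

HB.instance Definition _ :=
  GRing.isZmodMorphism.Build M tens tens2 tens2_zmod_morphism.
HB.instance Definition _ :=
  GRing.isMonoidMorphism.Build M tens tens2 tens2_monoid_morphism.

Section Lift.
Context (R : comNzRingType) (f : {rmorphism L -> R}) (g : {rmorphism M -> R}).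
Context (fg : forall e, f (iL e) = g (iM e)).

Let ev : {rmorphism P -> R} := pev P f g.

Let evX m : ev (X m) = g m.
Proof. exact: pevX. Qed.

Let evC x : ev (C x) = f x.
Proof. exact: pevC. Qed.

Let ev_rel p : ideal_gen tens_rel p -> ev p = 0.
Proof.
move=> /(_ (fun q => ev q = 0)); apply; first exact: ker_is_ideal.
move=> _ [m n|m n|e].
- by rewrite (rmorphB ev) (rmorphD ev) !evX rmorphD subrr.
- by rewrite (rmorphB ev) (rmorphM ev) !evX rmorphM subrr.
- by rewrite (rmorphB ev) evX evC fg subrr.
Qed.

Definition tens_lift (_ : forall e, f (iL e) = g (iM e)) (t : tens) : R :=
  ev (repr t).

Lemma tens_lift_pi p : tens_lift fg (tens_pi p) = ev p.
Proof.
rewrite /tens_lift; apply/eqP; rewrite -subr_eq0 -(rmorphB ev); apply/eqP.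
by apply: ev_rel; apply: (tens_piP _ _).2; rewrite /tens_pi reprK.
Qed.

Lemma tens_lift_zmod_morphism : zmod_morphism (tens_lift fg).
Proof.
move=> x y; have [p ->] := tens_pi_surj x; have [q ->] := tens_pi_surj y.
by rewrite -(rmorphB tens_pi) !tens_lift_pi (rmorphB ev).
Qed.

Lemma tens_lift_monoid_morphism : monoid_morphism (tens_lift fg).
Proof.
split=> [|x y]; first by rewrite -(rmorph1 tens_pi) tens_lift_pi (rmorph1 ev).
have [p ->] := tens_pi_surj x; have [q ->] := tens_pi_surj y.
by rewrite -(rmorphM tens_pi) !tens_lift_pi (rmorphM ev).
Qed.

HB.instance Definition _ := GRing.isZmodMorphism.Build tens R (tens_lift fg)
  tens_lift_zmod_morphism.
HB.instance Definition _ := GRing.isMonoidMorphism.Build tens R (tens_lift fg)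
  tens_lift_monoid_morphism.

Lemma tens_lift1 x : tens_lift fg (tens1 x) = f x.
Proof. by rewrite tens_lift_pi evC. Qed.

Lemma tens_lift2 m : tens_lift fg (tens2 m) = g m.
Proof. by rewrite tens_lift_pi evX. Qed.

End Lift.

Lemma tens_ext (R : comNzRingType) (u v : {rmorphism tens -> R}) :
  (forall x, u (tens1 x) = v (tens1 x)) ->
  (forall m, u (tens2 m) = v (tens2 m)) -> u =1 v.
Proof.
move=> uv1 uv2 t; have [p ->] := tens_pi_surj t.
exact: (@freepoly_ext _ _ R (u \o tens_pi) (v \o tens_pi)).
Qed.

End Tensor.

Section TensorMap.
Context (E : fieldType) (L M L' M' : comNzRingType).
Context (iL : {rmorphism E -> L}) (iM : {rmorphism E -> M}).
Context (u : {rmorphism L -> L'}) (v : {rmorphism M -> M'}).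

Fact tens_map_subproof e :
  (tens1 (u \o iL) (v \o iM) \o u) (iL e) =
  (tens2 (u \o iL) (v \o iM) \o v) (iM e).
Proof. exact: (tens12 (u \o iL) (v \o iM)). Qed.

Definition tens_map : {rmorphism tens iL iM -> tens (u \o iL) (v \o iM)} :=
  tens_lift tens_map_subproof.

End TensorMap.

Record GL (r : nat) (R : comNzRingType) := MkGL {
  glmx :> 'M[R]_r;
  glinv : 'M[R]_r;
  _ : (glmx *m glinv == 1%:M) && (glinv *m glmx == 1%:M)
}.

Section GLTheory.
Context (r : nat) (R : comNzRingType).
Implicit Types x y : GL r R.

Lemma glmulV x : x *m glinv x = 1%:M.
Proof. by case: x => a b /= /andP[/eqP]. Qed.

Lemma glmulVl x : glinv x *m x = 1%:M.
Proof. by case: x => a b /= /andP[_ /eqP]. Qed.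

Lemma GL_inj x y : glmx x = glmx y -> x = y.
Proof.
move=> xy; have : glinv x = glinv y.
  by rewrite -[glinv x]mulmx1 -(glmulV y) -xy mulmxA glmulVl mul1mx.
case: x y xy => a b p [c d q] /= ac bd; move: p q; rewrite ac bd => p q.
by rewrite (bool_irrelevance p q).
Qed.

Fact gl1_subproof :
  ((1%:M : 'M[R]_r) *m 1%:M == 1%:M) && (1%:M *m 1%:M == 1%:M :> 'M[R]_r).
Proof. by rewrite mulmx1 eqxx. Qed.
Definition GL1 : GL r R := MkGL gl1_subproof.

Fact glM_subproof x y :
  ((x *m y) *m (glinv y *m glinv x) == 1%:M) &&
  ((glinv y *m glinv x) *m (x *m y) == 1%:M).
Proof.
rewrite mulmxA -(mulmxA (glmx x)) glmulV mulmx1 glmulV eqxx /=.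
by rewrite mulmxA -(mulmxA (glinv y)) glmulVl mulmx1 glmulVl.
Qed.
Definition GLmul x y : GL r R := MkGL (glM_subproof x y).

Fact glV_subproof x : (glinv x *m x == 1%:M) && (x *m glinv x == 1%:M).
Proof. by rewrite glmulV glmulVl eqxx. Qed.
Definition GLinv x : GL r R := MkGL (glV_subproof x).

End GLTheory.

Section GLMap.
Context (r : nat) (R S : comNzRingType) (f : {rmorphism R -> S}).

Fact glmap_subproof (x : GL r R) :
  (map_mx f x *m map_mx f (glinv x) == 1%:M) &&
  (map_mx f (glinv x) *m map_mx f x == 1%:M).
Proof. by rewrite -!map_mxM glmulV glmulVl map_mx1 eqxx. Qed.
Definition GLmap (x : GL r R) : GL r S := MkGL (glmap_subproof x).

End GLMap.

Import mpoly.

Section GLCoord.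
Context (k : comNzRingType) (r : nat).

(** [k[X, Δ^-1]] is presented as [k[X_ij, t] / (Δ t - 1)]; the [r * r] first
    variables are the [X_ij] and the last one is [t]. *)
Definition GLpoly : comNzRingType := {mpoly k[r * r + 1]}.
Definition genX : 'M[GLpoly]_r :=
  \matrix_(i, j) ('X_(lshift 1 (mxvec_index i j)) : {mpoly k[r * r + 1]}).
Definition genT : GLpoly := ('X_(rshift (r * r) ord0) : {mpoly k[r * r + 1]}).

(** A closed subscheme of [GL_{r/k}] is an ideal of [k[X, Δ^-1]], that is, an
    ideal of [k[X, t]] containing [Δ t - 1]. *)
Record GLclosed := MkGLclosed {
  gl_ideal : GLpoly -> Prop;
  gl_ideal_ideal : is_ideal gl_ideal;
  gl_ideal_det : gl_ideal (\det genX * genT - 1)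
}.

Section Eval.
Context (R : comNzRingType) (f : {rmorphism k -> R}) (g : GL r R).

Definition glcoord : 'rV[R]_(r * r + 1) :=
  row_mx (mxvec g) (\det (glinv g))%:M.

(** The [k]-algebra morphism [k[X, Δ^-1] -> R] sending [X] to [g]. *)
Definition gleval : {rmorphism GLpoly -> R} := mmap f (glcoord 0).

Lemma gleval_X i j : gleval (genX i j) = g i j.
Proof.
rewrite mxE [LHS]mmapX mmap1U /glcoord row_mxEl; exact: mxvecE.
Qed.

Lemma gleval_T : gleval genT = \det (glinv g).
Proof. by rewrite [LHS]mmapX mmap1U /glcoord row_mxEr mxE eqxx. Qed.

Lemma gleval_det : gleval (\det genX * genT - 1) = 0.
Proof.
rewrite rmorphB rmorphM rmorph1 -det_map_mx gleval_T.
have -> : map_mx gleval genX = g by apply/matrixP => i j; rewrite mxE gleval_X.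
by rewrite -det_mulmx glmulV det1 subrr.
Qed.

(** [Spec k[X, Δ^-1] / p] where [p] is the kernel of [X |-> g]. *)
Definition GLker : GLclosed :=
  MkGLclosed (ker_is_ideal gleval) gleval_det.

(** The points of a closed subscheme with values in the [k]-algebra [R]. *)
Definition glpoint (Z : GLclosed) : Prop :=
  forall P, gl_ideal Z P -> gleval P = 0.

End Eval.
End GLCoord.

Section BaseChange.
Context (k k' : comNzRingType) (r : nat) (i : {rmorphism k -> k'}).

Definition GLpoly_map : {rmorphism GLpoly k r -> GLpoly k' r} := map_mpoly i.

Lemma GLpoly_map_X a b : GLpoly_map (genX k r a b) = genX k' r a b.
Proof. by rewrite /genX !mxE; exact: (map_mpolyX i). Qed.

Lemma GLpoly_map_T : GLpoly_map (genT k r) = genT k' r.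
Proof. exact: (map_mpolyX i). Qed.

Lemma GLpoly_map_det :
  GLpoly_map (\det (genX k r) * genT k r - 1) = \det (genX k' r) * genT k' r - 1.
Proof.
rewrite (rmorphB GLpoly_map) (rmorphM GLpoly_map) (rmorph1 GLpoly_map).
rewrite GLpoly_map_T; congr (_ * _ - 1); rewrite -det_map_mx; congr (\det _).
by apply/matrixP => a b; rewrite mxE GLpoly_map_X.
Qed.

Context (Z : GLclosed k r).

Fact GLbase_det :
  ideal_gen (fun q => exists2 p, gl_ideal Z p & q = GLpoly_map p)
    (\det (genX k' r) * genT k' r - 1).
Proof.
apply: ideal_gen_sub; exists (\det (genX k r) * genT k r - 1).
  exact: gl_ideal_det.
by rewrite GLpoly_map_det.
Qed.

(** Base change along [i]: the ideal is extended to [k'[X, Δ^-1]]. *)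
Definition GLbase : GLclosed k' r :=
  MkGLclosed (ideal_gen_is_ideal _) GLbase_det.

End BaseChange.

(** Subgroup schemes, stability and torsors are expressed on points with values
    in arbitrary nonzero commutative algebras (over the zero ring, every closed
    subscheme has exactly one point). *)
Section Torsors.
Context (k : fieldType) (r : nat).
Implicit Types Z G : GLclosed k r.

Definition gl_subgroup G : Prop :=
  forall (R : comNzRingType) (f : {rmorphism k -> R}),
  [/\ glpoint f (GL1 r R) G,
      (forall x y, glpoint f x G -> glpoint f y G -> glpoint f (GLmul x y) G) &
      (forall x, glpoint f x G -> glpoint f (GLinv x) G)].

Definition right_stable Z G : Prop :=
  forall (R : comNzRingType) (f : {rmorphism k -> R}) (z g : GL r R),
  glpoint f z Z -> glpoint f g G -> glpoint f (GLmul z g) Z.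

Definition left_stable Z G : Prop :=
  forall (R : comNzRingType) (f : {rmorphism k -> R}) (g z : GL r R),
  glpoint f g G -> glpoint f z Z -> glpoint f (GLmul g z) Z.

(** Every nonzero algebra over the field [k] is faithfully flat. *)
Definition fpqc_locally_nonempty Z : Prop :=
  exists (R : comNzRingType) (f : {rmorphism k -> R}) (z : GL r R),
    glpoint f z Z.

(** The last condition says that [Z × G -> Z × Z], [(z, g) |-> (z, z g)], is an
    isomorphism. *)
Definition right_torsor Z G : Prop :=
  [/\ gl_subgroup G, right_stable Z G, fpqc_locally_nonempty Z &
      forall (R : comNzRingType) (f : {rmorphism k -> R}) (z z' : GL r R),
        glpoint f z Z -> glpoint f z' Z ->
        exists! g : GL r R, glpoint f g G /\ z' = GLmul z g].

Definition left_torsor Z G : Prop :=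
  [/\ gl_subgroup G, left_stable Z G, fpqc_locally_nonempty Z &
      forall (R : comNzRingType) (f : {rmorphism k -> R}) (z z' : GL r R),
        glpoint f z Z -> glpoint f z' Z ->
        exists! g : GL r R, glpoint f g G /\ z' = GLmul g z].

End Torsors.

(** Separability of a not necessarily algebraic algebra over a field: it remains
    reduced after every extension of the base field. *)
Definition separable_algebra (E : fieldType) (L : comNzRingType)
    (i : {rmorphism E -> L}) : Prop :=
  forall (K : fieldType) (j : {rmorphism E -> K}) (x : tens i j) (n : nat),
    x ^+ n = 0 -> x = 0.

(** [Z/d] is represented by ['I_d] with the cyclic successor [ordS]; [L] is the
    product of the fields [st_Lf l] through the projections [st_pr l], and the
    factor [L_l] sits in [L] as the elements whose components other than the
    [l]-th vanish.  Morphisms out of a field are injective, so [st_iF] and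
    [st_iE] are the inclusions [F ⊂ E ⊂ L]. *)
Record sigma_triple := SigmaTriple {
  st_d : nat;
  st_d_gt0 : (0 < st_d)%N;
  st_F : fieldType;
  st_E : fieldType;
  st_Lf : 'I_st_d -> fieldType;
  st_L : comNzRingType;
  st_iF : {rmorphism st_F -> st_E};
  st_iE : {rmorphism st_E -> st_L};
  st_pr : forall l, {rmorphism st_L -> st_Lf l};
  st_prod : forall x : (forall l, st_Lf l), exists! y, forall l, st_pr l y = x l;
  st_sigma : {rmorphism st_L -> st_L};
  st_sigmaE : forall a, exists b, st_sigma (st_iE a) = st_iE b;
  st_sigmaL : forall l x, (forall m, m != l -> st_pr m x = 0) ->
    forall m, m != ordS l -> st_pr m (st_sigma x) = 0;
  st_fixE : forall a,
    st_sigma (st_iE a) = st_iE a <-> exists b, a = st_iF b;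
  st_fixL : forall x, st_sigma x = x <-> exists b, x = st_iE (st_iF b);
  st_sep : separable_algebra st_iE
}.

Section Galois.
Context (T : sigma_triple) (r : nat) (Psi : GL r (st_L T)).
Local Notation iF := (st_iF T).
Local Notation iE := (st_iE T).
Local Notation pr l := (@st_pr T l).
Local Notation index := 'I_(st_d T).

Definition index0 : index := Ordinal (st_d_gt0 T).

Definition galZ : GLclosed (st_E T) r := GLker iE Psi.

Definition galZl (l : index) : GLclosed (st_E T) r :=
  GLker (pr l \o iE) (GLmap (pr l) Psi).

Definition PsiT : GL r (tens iE iE) :=
  GLmul (GLinv (GLmap (tens1 iE iE) Psi)) (GLmap (tens2 iE iE) Psi).

(** The component [(Ψ~_ijlm)_ij] of [PsiT = Ψ_1^-1 Ψ_2] in [L_l ⊗_E L_m]. *)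
Definition PsiTlm (l m : index) : GL r (tens (pr l \o iE) (pr m \o iE)) :=
  GLmap (tens_map iE iE (pr l) (pr m)) PsiT.

Definition galG : GLclosed (st_F T) r :=
  GLker (tens1 iE iE \o (iE \o iF)) PsiT.

Definition galGm (m : index) : GLclosed (st_F T) r :=
  GLker (tens1 (pr index0 \o iE) (pr m \o iE) \o (pr index0 \o iE \o iF))
    (PsiTlm index0 m).

End Galois.

(* Main.v *)
(** Both kinds of torsor statement are formal consequences of a groupoid structure:
    with [Γ_ij] the closure over [F] of [Ψ_i^-1 ⊗ Ψ_j], it suffices to show
    [Z_i^-1 Z_j ⊂ Γ_ij] and [Z_i Γ_ij ⊂ Z_j] on points, a point of [Γ_ij] over an
    [F]-algebra being tested after a faithful extension where [Z_i] has a point.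
    The first inclusion holds because [E[Z_i] ⊗_E E[Z_j]] embeds in [L_i ⊗_E L_j].
    For the second, the coordinates of [Ψ_i^-1 ⊗ Ψ_j] are fixed by [σ^d ⊗ σ^d]
    while the fixed field of [σ^d] on [L_i] is [F]; so, by Artin's argument, an
    [L_i]-linear relation between polynomials over [F] in these coordinates is a
    combination of [F]-linear ones, and an equation of [Z_j] evaluated at [z g]
    vanishes with them.  Finally [σ ⊗ σ] identifies all the [Γ_ll], and embeds the
    invariants of [L ⊗_E L] into [L_l ⊗_E L]. *)

Require Import Defs.
From HB Require Import structures.
From mathcomp Require Import all_boot all_order all_algebra.
From mathcomp Require boolp classical_sets.
From mathcomp.multinomials Require mpoly.

Set Implicit Arguments.
Unset Strict Implicit.
Unset Printing Implicit Defensive.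

Import GRing.Theory.
Local Open Scope ring_scope.

(** * Linear functionals *)

Section Functionals.
Context (E : fieldType) (M : comNzRingType) (i : {rmorphism E -> M}).

Definition subspace (V : M -> Prop) : Prop :=
  [/\ V 0, (forall x y, V x -> V y -> V (x + y)) &
      (forall e x, V x -> V (i e * x))].

Definition functional (psi : M -> E) : Prop :=
  {morph psi : x y / x + y} /\ forall e x, psi (i e * x) = e * psi x.

Lemma functional0 psi : functional psi -> psi 0 = 0.
Proof. by move=> [_ /(_ 0 0)]; rewrite mulr0 mul0r. Qed.

Lemma functional_sum psi (I : Type) (s : seq I) (G : I -> M) :
  functional psi -> psi (\sum_(k <- s) G k) = \sum_(k <- s) psi (G k).
Proof.
move=> fpsi; apply: (big_morph psi); first by case: fpsi.
exact: functional0.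
Qed.

Lemma functionalB psi x y : functional psi -> psi (x - y) = psi x - psi y.
Proof.
by move=> [psiD psiZ]; rewrite psiD -[- y]mulN1r -(rmorphN1 i) psiZ mulN1r.
Qed.

Lemma subspace0 : subspace (fun x => x = 0).
Proof. by split=> // [x y -> ->|e x ->]; rewrite ?addr0 ?mulr0. Qed.

Lemma subspaceN V x : subspace V -> V x -> V (- x).
Proof. by move=> [_ _ VZ] /(VZ (-1)); rewrite rmorphN1 mulN1r. Qed.

(** Zorn's lemma supplies the future kernel of a functional that separates [x] from [W]. *)
Lemma subspace_maximal (W : M -> Prop) (x : M) : subspace W -> ~ W x ->
  exists V, [/\ subspace V, (forall y, W y -> V y), ~ V x &
    forall B, subspace B -> (forall y, V y -> B y) -> ~ B x ->
      forall y, B y -> V y].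
Proof.
move=> sW Wx.
(* The inclusion of W is only demanded of nonempty sets: Zorn_bigcup also
   covers the empty chain, whose union is empty. *)
pose P (V : M -> Prop) :=
  (exists z, V z) -> [/\ subspace V, (forall y, W y -> V y) & ~ V x].
have [V [PV maxV]] : exists V, P V /\
    forall B : M -> Prop, classical_sets.proper V B -> ~ P B.
  apply: (@classical_sets.Zorn_bigcup M P) => F FP Ftot [z [X FX Xz]].
  have [[X0 XD XZ] WX nXx] : [/\ subspace X, (forall y, W y -> X y) & ~ X x].
    by apply: (FP _ FX); exists z.
  have good Y w : F Y -> Y w ->
      [/\ subspace Y, (forall y, W y -> Y y) & ~ Y x].
    by move=> FY Yw; apply: (FP _ FY); exists w.
  split; [split|by move=> y /WX; exists X|].
  - by exists X.
  - move=> y y' [Y FY Yy] [Y' FY' Yy'].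
    have [le|le] := Ftot _ _ FY FY'.
    + exists Y' => //; have [[_ + _] _ _] := good _ _ FY' Yy'.
      by apply => //; apply: le.
    + exists Y => //; have [[_ + _] _ _] := good _ _ FY Yy.
      by apply => //; apply: le.
  - move=> e y [Y FY Yy]; exists Y => //.
    by have [[_ _ +] _ _] := good _ _ FY Yy; apply.
  - by move=> [Y FY Yx]; have [_ _] := good _ _ FY Yx; apply.
have [[z Vz]|V0] := boolp.EM (exists z, V z).
  have [sV WV nVx] : [/\ subspace V, (forall y, W y -> V y) & ~ V x].
    by apply: PV; exists z.
  exists V; split=> // B sB VB nBx y By; apply: boolp.contrapT => nVy.
  apply: (maxV B); last by move=> _; split=> // w /WV /VB.
  by split=> // BV; apply: nVy; apply: BV.
(* An empty [V] satisfies [P] vacuously, but then [W] properly contains it and satisfies [P] too. *)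
case: (maxV W); last by [].
split; first by move=> y Vy; case: V0; exists y.
by case: (sW) => W0 _ _ /(_ 0 W0) VV; apply: V0; exists 0.
Qed.

(** A subspace [V] maximal among those missing [x] has codimension one: every vector is congruent
    modulo [V] to exactly one multiple of [x], and [psi] reads off the coefficient. *)
Lemma functional_separation (W : M -> Prop) (x : M) : subspace W -> ~ W x ->
  exists psi, [/\ functional psi, (forall y, W y -> psi y = 0) & psi x = 1].
Proof.
move=> sW Wx; have [V [sV WV Vx maxV]] := subspace_maximal sW Wx.
have [V0 VD VZ] := sV; have VN := fun y => @subspaceN V y sV.
have dec y : exists e, V (y - i e * x).
  have [Vy|Vy] := boolp.EM (V y); first by exists 0; rewrite rmorph0 mul0r subr0.
  (* [B] is the span of [V] and [y]. If it misses [x], maximality forces [y] into [V]; otherwise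
     [x = v + i e * y] with [e] nonzero is solved for [y]. *)
  pose B z := exists v e, V v /\ z = v + i e * y.
  have sB : subspace B.
    split; first by exists 0, 0; rewrite rmorph0 mul0r addr0.
    - move=> _ _ [v [e [Vv ->]]] [w [f [Vw ->]]]; exists (v + w), (e + f).
      by split; [exact: VD|rewrite rmorphD mulrDl addrACA].
    - move=> f _ [v [e [Vv ->]]]; exists (i f * v), (f * e).
      by split; [exact: VZ|rewrite rmorphM mulrDr mulrA].
  have [[v [e [Vv xE]]]|Bx] := boolp.EM (B x); last first.
    case: Vy; apply: (maxV B) => //; last by exists 0, 1; rewrite rmorph1 mul1r add0r.
    by move=> v Vv; exists v, 0; rewrite rmorph0 mul0r addr0.
  have e0 : e != 0.
    by apply/eqP => e0; apply: Vx; rewrite xE e0 rmorph0 mul0r addr0.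
  exists e^-1; have -> : y - i e^-1 * x = i (- e^-1) * v.
    rewrite xE mulrDr mulrA -rmorphM mulVf // rmorph1 mul1r rmorphN mulNr.
    by rewrite opprD addrCA subrr addr0.
  exact: VZ.
have uniq y e f : V (y - i e * x) -> V (y - i f * x) -> e = f.
  move=> Ve Vf; apply: boolp.contrapT => ef; apply: Vx.
  have d0 : f - e != 0 by rewrite subr_eq0 eq_sym; apply/eqP.
  have := VZ (f - e)^-1 _ (VD _ _ (VN _ Vf) Ve).
  by rewrite opprB addrA subrK -mulrBl -rmorphB mulrA -rmorphM mulVf // rmorph1 mul1r.
pose psi y := sval (boolp.cid (dec y)).
have psiP y : V (y - i (psi y) * x) by rewrite /psi; case: boolp.cid.
exists psi; split; first split.
- move=> y z; apply: (uniq (y + z)) => //.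
  by rewrite rmorphD mulrDl opprD addrACA; apply: VD.
- move=> e y; apply: (uniq (i e * y)) => //.
  by rewrite rmorphM -mulrA -mulrBr; apply: VZ.
- move=> y Wy; apply: (uniq y) => //.
  by rewrite rmorph0 mul0r subr0; apply: WV.
- by apply: (uniq x) => //; rewrite rmorph1 mul1r subrr.
Qed.

(** The [psi k] are coordinates modulo [W] along a finite family that may be linearly dependent;
    they do the work of a basis of [M/W]. *)
Lemma finite_projector (W : M -> Prop) (s : seq M) : subspace W ->
  exists psi : nat -> M -> E, [/\ forall k, functional (psi k),
    (forall k y, W y -> psi k y = 0) &
    forall x, x \in s -> W (x - \sum_(k < size s) i (psi k x) * s`_k)].
Proof.
move=> sW; elim: s => [|x s [psi [fpsi Wpsi spsi]]].
  exists (fun _ _ => 0); split=> // k; split=> [y z|e y]; first by rewrite addr0.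
  by rewrite mulr0.
have [W0 WD WZ] := sW; have WN := fun y => @subspaceN W y sW.
pose pr y := \sum_(k < size s) i (psi k y) * s`_k.
have prD y z : pr (y + z) = pr y + pr z.
  rewrite -big_split; apply: eq_bigr => k _ /=.
  by have [-> _] := fpsi k; rewrite rmorphD mulrDl.
have prZ e y : pr (i e * y) = i e * pr y.
  rewrite mulr_sumr; apply: eq_bigr => k _ /=.
  by have [_ ->] := fpsi k; rewrite rmorphM mulrA.
have prW y : W y -> pr y = 0.
  by move=> Wy; apply: big1 => k _; rewrite Wpsi // rmorph0 mul0r.
(* [V] consists of the vectors that the projector of the tail already reproduces modulo [W]. *)
pose V y := W (y - pr y).
have sV : subspace V.
  split; first by rewrite /V prW // subrr.
  - by move=> y z Vy Vz; rewrite /V prD opprD addrACA; apply: WD.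
  - by move=> e y Vy; rewrite /V prZ -mulrBr; apply: WZ.
have WV y : W y -> V y by move=> Wy; rewrite /V prW // subr0.
have [Vx|nVx] := boolp.EM (V x).
  (* The head [x] is already reproduced: it gets the zero coordinate, and the others shift by
     one. *)
  exists (fun k => if k is k'.+1 then psi k' else fun _ => 0); split.
  - move=> [|k] //; split=> [y z|e y]; first by rewrite addr0.
    by rewrite mulr0.
  - by move=> [|k] // y; apply: Wpsi.
  - move=> y ys; rewrite /= big_ord_recl rmorph0 mul0r add0r.
    by move: ys; rewrite inE => /predU1P[->|/spsi].
have [phi [fphi phiV phix]] := functional_separation sV nVx.
have [phiD phiZ] := fphi.
(* The new projector is [y |-> pr y + i (phi y) * (x - pr x)]: it agrees with [pr] on [V], where
   [phi] vanishes, and fixes [x]. *)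
pose psi' k y := psi k y - psi k x * phi y.
exists (fun k => if k is k'.+1 then psi' k' else phi); split.
- move=> [|k] //; rewrite /psi'; have [psiD psiZ] := fpsi k.
  split=> [y z|e y]; first by rewrite psiD phiD mulrDr opprD addrACA.
  by rewrite psiZ phiZ mulrBr mulrCA.
- move=> [|k] y Wy; first by apply: phiV; apply: WV.
  by rewrite /psi' Wpsi // phiV ?mulr0 ?subr0 //; apply: WV.
- move=> y ys; rewrite /= big_ord_recl /=.
  have -> : \sum_(k < size s) i (psi' k y) * s`_k = pr y - i (phi y) * pr x.
    rewrite mulr_sumr -sumrB; apply: eq_bigr => k _ /=.
    by rewrite rmorphB mulrBl [psi k x * _]mulrC rmorphM mulrA.
  move: ys; rewrite inE => /predU1P[->|/spsi Vy].
    by rewrite phix rmorph1 !mul1r subrr addr0 subrr.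
  by rewrite (phiV _ Vy) rmorph0 !mul0r add0r subr0.
Qed.

End Functionals.

(** * Vanishing in tensor products *)

Section TensorSums.
Context (E : fieldType) (L M : comNzRingType).
Context (iL : {rmorphism E -> L}) (iM : {rmorphism E -> M}).
Local Notation P := (freepoly L M).
Local Notation X := (@pX L M).
Local Notation C := (pC (freepoly L M)).

(** This is the map [id ⊗ phi] from [L ⊗_E M] to [L]. It is built as an [L]-linear form [lam] on the
    polynomial ring, sending a monomial to [phi] of its value in [M], and it kills every multiple of
    a defining relation. *)
Lemma tens_functional_eq0 (s : seq (L * M)) (phi : M -> E) : functional iM phi ->
  \sum_(k <- s) tens1 iL iM k.1 * tens2 iL iM k.2 = 0 ->
  \sum_(k <- s) k.1 * iL (phi k.2) = 0.
Proof.
move=> [phiD phiZ].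
have [h [h1 hX]] := polyring_monomials M.
have [lam [lamD lam0 lamE]] :=
  polyring_functional (freepoly L M) (fun k => iL (phi (h k))).
have lamN x : lam (- x) = - lam x.
  by apply/eqP; rewrite -addr_eq0 -lamD addNr lam0.
have lamX c k m : lam (C c * pM (freepoly L M) k * X m) = c * iL (phi (h k * m)).
  by rewrite -mulrA -pMM lamE hX.
pose p := \sum_(k <- s) C k.1 * X k.2.
have -> : \sum_(k <- s) tens1 iL iM k.1 * tens2 iL iM k.2 = tens_pi iL iM p.
  by rewrite rmorph_sum; apply: eq_bigr => k _; rewrite rmorphM.
rewrite -(rmorph0 (tens_pi iL iM)) => /(tens_piP iL iM _ _).2; rewrite subr0.
move=> /(ideal_gen_functional lamD lam0) H.
have <- : lam p = \sum_(k <- s) k.1 * iL (phi k.2).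
  rewrite (big_morph lam lamD lam0); apply: eq_bigr => k _.
  by rewrite -[C k.1]mulr1 -(pM1 (freepoly L M)) lamX h1 mul1r.
apply: H => y Sy f; have [r [c ->]] := polyringE f.
rewrite mulr_suml; apply: (big_ind (fun z => lam z = 0)) => // [x z hx hz|k _].
  by rewrite lamD hx hz addr0.
case: Sy => [m n|m n|e].
- by rewrite mulrBr mulrDr lamD lamN lamD !lamX mulrDr phiD rmorphD mulrDr subrr.
- rewrite mulrBr mulrA lamD lamN lamX.
  by rewrite -[_ * _ * X m]mulrA -pMM lamX hX mulrA subrr.
- rewrite mulrBr lamD lamN lamX [_ * iM e]mulrC phiZ rmorphM.
  by rewrite [_ * C (iL e)]mulrAC -(rmorphM C) lamE mulrA subrr.
Qed.

(** Once the second factors are expanded along finitely many [t_j], the hypothesis for the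
    coordinate [psi j] says that the coefficient of [t_j] vanishes. *)
Lemma tens_eq0 (s : seq (L * M)) :
  (forall phi, functional iM phi -> \sum_(k <- s) k.1 * iL (phi k.2) = 0) ->
  \sum_(k <- s) tens1 iL iM k.1 * tens2 iL iM k.2 = 0.
Proof.
move=> H.
have [psi [fpsi _ psiP]] := finite_projector [seq k.2 | k <- s] (subspace0 iM).
set t := [seq k.2 | k <- s] in psiP.
pose g (k : L * M) (j : 'I_(size t)) : tens iL iM :=
  tens1 iL iM (k.1 * iL (psi j k.2)) * tens2 iL iM t`_j.
transitivity (\sum_(k <- s) \sum_j g k j).
  apply: eq_big_seq => k ks; have /eqP := psiP _ (map_f snd ks).
  rewrite subr_eq0 => /eqP {1}->; rewrite rmorph_sum mulr_sumr.
  by apply: eq_bigr => j _; rewrite /g (rmorphM (tens1 _ _)) (rmorphM (tens2 _ _)) /=;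
    rewrite tens12 mulrA.
rewrite exchange_big big1 // => j _.
by rewrite -mulr_suml -rmorph_sum H // rmorph0 mul0r.
Qed.

(** A functional on [M] with value 1 at 1 retracts [L ⊗_E M] onto [L]. *)
Lemma tens1_inj : injective (tens1 iL iM).
Proof.
move=> x y xy; apply/eqP; rewrite -subr_eq0; apply/eqP.
have [psi [psiD psiZ psi1]] := unital_functional iM.
have := @tens_functional_eq0 [:: (x - y, 1)] psi.
rewrite !big_seq1 /= psi1 !rmorph1 !mulr1; apply; first by split.
by rewrite rmorphB /= xy subrr.
Qed.

End TensorSums.

(** * Coordinates of [GL_r] *)

Section Coordinates.
Import mpoly.
Context (k : comNzRingType) (r : nat).

Definition glC : {rmorphism k -> GLpoly k r} := @mpolyC (r * r + 1) k.

Lemma GLpoly_ind (K : GLpoly k r -> Prop) :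
  (forall c, K (glC c)) -> (forall p q, K p -> K q -> K (p + q)) ->
  (forall p q, K p -> K q -> K (p * q)) ->
  (forall i j, K (genX k r i j)) -> K (genT k r) -> forall p, K p.
Proof.
move=> KC KD KM KX KT p; rewrite [p](mpolyE (p : {mpoly k[r * r + 1]})).
have K0 : K 0 by rewrite -(rmorph0 glC).
have K1 : K 1 by rewrite -(rmorph1 glC).
apply: (big_ind K) => // m _; rewrite -mul_mpolyC; apply: (KM (glC _)) => //.
rewrite mpolyXE_id; apply: (big_ind K) => // i _.
elim: (m i) => [|n IHn]; first by rewrite expr0.
rewrite exprS; apply: KM => //.
rewrite -(splitK i); case: (split i) => [j|j] /=.
  by case/mxvec_indexP: j => a b; have := KX a b; rewrite mxE.
by rewrite [j]ord1.
Qed.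

Section Eval.
Context (R : comNzRingType) (f : {rmorphism k -> R}) (g : GL r R).

Lemma gleval_C c : gleval f g (glC c) = f c.
Proof. exact: mmapC. Qed.

End Eval.

Lemma gleval_morph (R R' : comNzRingType) (u : {rmorphism R -> R'})
    (f : {rmorphism k -> R}) (f' : {rmorphism k -> R'}) (g : GL r R)
    (g' : GL r R') :
  (forall c, u (f c) = f' c) -> map_mx u g = g' ->
  forall P, u (gleval f g P) = gleval f' g' P.
Proof.
move=> uf ug; have {ug} <- : GLmap u g = g' by apply: GL_inj.
elim/GLpoly_ind => [c|p q IHp IHq|p q IHp IHq|i j|].
- by rewrite !gleval_C.
- by rewrite (rmorphD (gleval f g)) (rmorphD (gleval f' _)) rmorphD IHp IHq.
- by rewrite (rmorphM (gleval f g)) (rmorphM (gleval f' _)) rmorphM IHp IHq.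
- by rewrite !gleval_X /= mxE.
- by rewrite !gleval_T /= det_map_mx.
Qed.

Lemma gleval_ext (R : comNzRingType) (f f' : {rmorphism k -> R}) (g : GL r R) :
  f =1 f' -> gleval f g =1 gleval f' g.
Proof.
move=> ff' P; apply: (@gleval_morph _ _ idfun) => // .
by apply/matrixP => i j; rewrite mxE.
Qed.

(** These are the scheme endomorphisms of [GL_r]. [U] gives the matrix coordinates; [D] is needed
    for the extra coordinate [t], the determinant of the inverse. *)
Definition polynomial_map (u : forall R : comNzRingType, GL r R -> GL r R) :=
  exists (U : 'M[GLpoly k r]_r) (D : GLpoly k r),
  forall (R : comNzRingType) (f : {rmorphism k -> R}) (g : GL r R),
    (forall i j, gleval f g (U i j) = u R g i j) /\
    gleval f g D = \det (glinv (u R g)).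

Lemma polynomial_id : polynomial_map (fun R g => g).
Proof.
exists (genX k r), (genT k r) => R f g.
by split=> [i j|]; rewrite ?gleval_X ?gleval_T.
Qed.

(** By Cramer's rule the inverse is [t] times the adjugate. *)
Lemma polynomial_inv : polynomial_map (fun R g => GLinv g).
Proof.
exists (genT k r *: \adj (genX k r)), (\det (genX k r)) => R f g.
have Xg : map_mx (gleval f g) (genX k r) = g.
  by apply/matrixP => i j; rewrite mxE gleval_X.
split=> [i j|]; last by rewrite -det_map_mx Xg.
rewrite mxE (rmorphM (gleval f g)) gleval_T.
have adjE : \det (glinv g) *: \adj g = glinv g.
  rewrite -[\adj g]mul1mx -(glmulVl g) -mulmxA mul_mx_adj mul_mx_scalar.
  by rewrite scalerA -det_mulmx glmulVl det1 scale1r.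
transitivity ((\det (glinv g) *: \adj g) i j); last by rewrite adjE.
rewrite [RHS]mxE; congr (_ * _).
transitivity (map_mx (gleval f g) (\adj (genX k r)) i j).
  by rewrite [RHS]mxE.
by rewrite map_mx_adj Xg.
Qed.

End Coordinates.

Lemma gleval_map (k k' R : comNzRingType) (r : nat) (i : {rmorphism k -> k'})
    (f : {rmorphism k' -> R}) (g : GL r R) (P : GLpoly k r) :
  gleval f g (GLpoly_map r i P) = gleval (f \o i) g P.
Proof.
elim/GLpoly_ind: P => [c|p q IHp IHq|p q IHp IHq|a b|].
- transitivity (gleval f g (glC k' r (i c))); last by rewrite !gleval_C.
  congr (gleval f g _); exact: (mpoly.map_mpolyC (r * r + 1) i).
- by rewrite (rmorphD (GLpoly_map r i)) (rmorphD (gleval f g)) IHp IHq;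
    rewrite (rmorphD (gleval (f \o i) g)).
- by rewrite (rmorphM (GLpoly_map r i)) (rmorphM (gleval f g)) IHp IHq;
    rewrite (rmorphM (gleval (f \o i) g)).
- by rewrite GLpoly_map_X !gleval_X.
- by rewrite GLpoly_map_T !gleval_T.
Qed.

(** This is comultiplication, twisted by [u]. All constants go to the left factor, so the
    polynomials in [x] keep coefficients in the smaller ring [k]. *)
Lemma GLpoly_decomposition (k k' : comNzRingType) (r : nat)
    (i : {rmorphism k -> k'}) (u : forall R : comNzRingType, GL r R -> GL r R)
    (P : GLpoly k' r) : polynomial_map k' u ->
  exists s : seq (GLpoly k' r * GLpoly k r),
  forall (R : comNzRingType) (f : {rmorphism k' -> R}) (y x : GL r R),
    gleval f (GLmul (u R y) x) P =
    \sum_(c <- s) gleval f y c.1 * gleval (f \o i) x c.2.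
Proof.
move=> [U [D UD]].
elim/GLpoly_ind: P => [c|p q [s sE] [t tE]|p q [s sE] [t tE]|a b|].
- exists [:: (glC k' r c, 1)] => R f y x.
  by rewrite big_seq1 !gleval_C rmorph1 mulr1.
- by exists (s ++ t) => R f y x; rewrite big_cat rmorphD sE tE.
- exists [seq (c.1 * d.1, c.2 * d.2) | c <- s, d <- t] => R f y x.
  rewrite rmorphM sE tE big_allpairs_dep mulr_suml; apply: eq_bigr => c _.
  by rewrite mulr_sumr; apply: eq_bigr => d _; rewrite !rmorphM mulrACA.
- exists [seq (U a j, genX k r j b) | j <- enum 'I_r] => R f y x.
  rewrite gleval_X mxE big_map big_enum; apply: eq_bigr => j _.
  by cbn [fst snd]; rewrite gleval_X; have [-> _] := UD R f y.
- exists [:: (D, genT k r)] => R f y x.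
  rewrite big_seq1 !gleval_T det_mulmx mulrC; have [_ ->] := UD R f y.
  by [].
Qed.

(** * Quotients and translates of points *)

Lemma ideal_subspace (k : fieldType) (M : comNzRingType)
    (i : {rmorphism k -> M}) (I : M -> Prop) : is_ideal I -> subspace i I.
Proof. by move=> [I0 ID IM]; split=> // e x; apply: IM. Qed.

Lemma GLkerE (k R : comNzRingType) (r : nat) (f : {rmorphism k -> R})
  (g : GL r R) P : gl_ideal (GLker f g) P = (gleval f g P = 0).
Proof. by []. Qed.

(** * Linear relations between invariants of a semilinear endomorphism *)

Section SemilinearInvariants.
Context (F K : fieldType) (i : {rmorphism F -> K}) (tau : {rmorphism K -> K}).
Context (N : comNzRingType) (j : {rmorphism K -> N}).
Context (tauN : {rmorphism N -> N}).
Context (V : comNzRingType) (iV : {rmorphism F -> V}).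
Context (theta : {rmorphism V -> N}).
Hypothesis tau_fixed : forall x, tau x = x <-> exists c, x = i c.
Hypothesis tauN_semilinear : forall x, tauN (j x) = j (tau x).
Hypothesis theta_linear : forall c, theta (iV c) = j (i c).
Hypothesis theta_fixed : forall v, tauN (theta v) = theta v.

(* Artin's argument; it says that [K ⊗_F (V / ker theta) -> N] is injective. *)
Lemma invariants_disjoint (s : seq (K * V)) (psi : V -> F) :
  \sum_(k <- s) j k.1 * theta k.2 = 0 ->
  functional iV psi -> (forall v, theta v = 0 -> psi v = 0) ->
  \sum_(k <- s) k.1 * i (psi k.2) = 0.
Proof.
(* The induction bounds the number of terms and keeps [psi] general, since shorter relations are
   tested on other functionals. *)
move=> + fpsi; move: s {-2}s fpsi (leqnn (size s)).
move=> s0 s; move: (size s0) => n {s0}.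
elim: n s psi => [|n IHn] [|[a v] s] psi fpsi //; rewrite ?big_nil //= ltnS => sn.
rewrite !big_cons /= => sum0 kpsi.
have [a0|a0] := eqVneq a 0.
  rewrite a0 mul0r add0r; apply: IHn => //.
  by move: sum0; rewrite a0 rmorph0 mul0r add0r.
pose b (k : K * V) := k.1 / a.
have sumb : theta v + \sum_(k <- s) j (b k) * theta k.2 = 0.
  rewrite -[RHS](mulr0 (j a^-1)) -[in RHS]sum0 mulrDr mulr_sumr; congr (_ + _).
    by rewrite mulrA -rmorphM mulVf // rmorph1 mul1r.
  by apply: eq_bigr => k _; rewrite /b rmorphM [j k.1 * _]mulrC mulrA.
(* With first coefficient 1, subtracting the relation from its image under [tauN] removes the first
   term and leaves the coefficients [tau (b k) - b k]. By induction the sum is fixed by [tau], hence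
   lies in [F]. *)
have bfixed psi' : functional iV psi' -> (forall v, theta v = 0 -> psi' v = 0) ->
    exists c, \sum_(k <- s) b k * i (psi' k.2) = i c.
  move=> fpsi' kpsi'; apply/tau_fixed; apply/eqP; rewrite -subr_eq0; apply/eqP.
  pose s' := [seq (tau (b k) - b k, k.2) | k <- s].
  have : \sum_(k <- s') k.1 * i (psi' k.2) = 0.
    apply: IHn => //; first by rewrite size_map.
    rewrite big_map /=; under eq_bigr do rewrite rmorphB mulrBl.
    rewrite sumrB; apply/eqP; rewrite subr_eq0; apply/eqP.
    apply: (addrI (theta v)); rewrite sumb -[RHS](rmorph0 tauN) -[in RHS]sumb.
    rewrite rmorphD rmorph_sum theta_fixed; congr (_ + _).
    by apply: eq_bigr => k _; rewrite rmorphM tauN_semilinear theta_fixed.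
  rewrite big_map /= => sum'0; rewrite -[RHS]sum'0.
  under [in RHS]eq_bigr do rewrite mulrBl.
  rewrite sumrB rmorph_sum; congr (_ - _); apply: eq_bigr => k _.
  by rewrite rmorphM; congr (_ * _); apply/tau_fixed; exists (psi' k.2).
(* The tail is expanded modulo the kernel of [theta]; by [bfixed] the collected coefficients [c l]
   lie in [F]. *)
have sW := ideal_subspace iV (ker_is_ideal theta).
have [phi [fphi kphi phiP]] := finite_projector [seq k.2 | k <- s] sW.
set t := [seq k.2 | k <- s] in phiP.
pose c l := sval (boolp.cid (bfixed _ (fphi l) (kphi l))).
have cP l : \sum_(k <- s) b k * i (phi l k.2) = i (c l).
  by rewrite /c; case: boolp.cid.
have sE k : k \in s -> theta k.2 = \sum_(l < size t) j (i (phi l k.2)) * theta t`_l.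
  move=> ks; have /eqP := phiP _ (map_f snd ks).
  rewrite rmorphB subr_eq0 => /eqP ->; rewrite rmorph_sum.
  by apply: eq_bigr => l _; rewrite rmorphM theta_linear.
have psiE k : k \in s -> psi k.2 = \sum_(l < size t) phi l k.2 * psi t`_l.
  move=> ks; have /kpsi /eqP := phiP _ (map_f snd ks).
  rewrite (functionalB _ _ fpsi) subr_eq0 => /eqP ->; rewrite (functional_sum _ _ fpsi).
  by apply: eq_bigr => l _; have [_ ->] := fpsi.
(* The relation has become [F]-linear: a single element of the kernel of [theta], which [psi]
   kills. *)
have /kpsi : theta (v + \sum_(l < size t) iV (c l) * t`_l) = 0.
  rewrite -[RHS]sumb rmorphD rmorph_sum; congr (_ + _).
  transitivity (\sum_(k <- s) \sum_(l < size t)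
    j (b k) * (j (i (phi l k.2)) * theta t`_l)).
    rewrite exchange_big; apply: eq_bigr => l _ /=.
    rewrite rmorphM theta_linear -cP rmorph_sum mulr_suml.
    by apply: eq_bigr => k _; rewrite rmorphM mulrA.
  by apply: eq_big_seq => k ks; rewrite -mulr_sumr -sE.
have [psiD psiZ] := fpsi; rewrite psiD (functional_sum _ _ fpsi) => psi0.
have bpsi : i (psi v) + \sum_(k <- s) b k * i (psi k.2) = 0.
  rewrite -[RHS](rmorph0 i) -[in RHS]psi0 rmorphD rmorph_sum; congr (_ + _).
  transitivity (\sum_(k <- s) \sum_(l < size t) b k * (i (phi l k.2) * i (psi t`_l))).
    apply: eq_big_seq => k ks; rewrite psiE // rmorph_sum mulr_sumr.
    by apply: eq_bigr => l _; rewrite rmorphM.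
  rewrite exchange_big; apply: eq_bigr => l _ /=.
  rewrite psiZ rmorphM -cP mulr_suml.
  by apply: eq_bigr => k _; rewrite mulrA.
rewrite -[RHS](mulr0 a) -[in RHS]bpsi mulrDr mulr_sumr; congr (_ + _).
by apply: eq_bigr => k _; rewrite /b mulrA [a * _]mulrC divfK.
Qed.

End SemilinearInvariants.

(** * The scheme of differences between two solutions *)

Section Cocycle.
Context (F E : fieldType) (iF : {rmorphism F -> E}) (r : nat).

Section Definitions.
Context (L1 L2 : comNzRingType).
Context (i1 : {rmorphism E -> L1}) (i2 : {rmorphism E -> L2}).
Context (Psi1 : GL r L1) (Psi2 : GL r L2).

Definition difference_point : GL r (tens i1 i2) :=
  GLmul (GLinv (GLmap (tens1 i1 i2) Psi1)) (GLmap (tens2 i1 i2) Psi2).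

Definition difference_scheme : GLclosed F r :=
  GLker (tens1 i1 i2 \o (i1 \o iF)) difference_point.

Lemma difference_point_mul :
  GLmul (GLmap (tens1 i1 i2) Psi1) difference_point = GLmap (tens2 i1 i2) Psi2.
Proof.
by apply: GL_inj; rewrite /= mulmxA -map_mxM glmulV map_mx1 mul1mx.
Qed.

Lemma gleval_tens1 (P : GLpoly E r) :
  gleval (tens1 i1 i2 \o i1) (GLmap (tens1 i1 i2) Psi1) P =
  tens1 i1 i2 (gleval i1 Psi1 P).
Proof. by symmetry; apply: gleval_morph. Qed.

Lemma gleval_tens2 (P : GLpoly E r) :
  gleval (tens1 i1 i2 \o i1) (GLmap (tens2 i1 i2) Psi2) P =
  tens2 i1 i2 (gleval i2 Psi2 P).
Proof.
by symmetry; apply: gleval_morph => // c; rewrite /= tens12.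
Qed.

End Definitions.

(** One list [s] serves all points and all pairs of solutions, so a relation found at [Psi1], [Psi2]
    can be transported to other points. *)
Lemma difference_point_decomposition (P : GLpoly F r) :
  exists s : seq (GLpoly E r * GLpoly E r),
    (forall (R : comNzRingType) (f : {rmorphism E -> R}) (y x : GL r R),
      gleval (f \o iF) (GLmul (GLinv y) x) P =
      \sum_(c <- s) gleval f y c.1 * gleval f x c.2) /\
    forall (L1 L2 : comNzRingType) (i1 : {rmorphism E -> L1})
      (i2 : {rmorphism E -> L2}) (Psi1 : GL r L1) (Psi2 : GL r L2),
      gleval (tens1 i1 i2 \o (i1 \o iF)) (difference_point i1 i2 Psi1 Psi2) P =
      \sum_(c <- s) tens1 i1 i2 (gleval i1 Psi1 c.1) *
        tens2 i1 i2 (gleval i2 Psi2 c.2).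
Proof.
have [s sE] := GLpoly_decomposition idfun (GLpoly_map r iF P) (polynomial_inv E r).
have sE' (R : comNzRingType) (f : {rmorphism E -> R}) (y x : GL r R) :
    gleval (f \o iF) (GLmul (GLinv y) x) P =
    \sum_(c <- s) gleval f y c.1 * gleval f x c.2.
  rewrite -gleval_map sE; apply: eq_bigr => c _.
  by congr (_ * _); apply: gleval_ext.
exists s; split=> // L1 L2 i1 i2 Psi1 Psi2.
rewrite (@gleval_ext _ _ _ _ ((tens1 i1 i2 \o i1) \o iF)) // sE'.
by apply: eq_bigr => c _; congr (_ * _); [exact: gleval_tens1|exact: gleval_tens2].
Qed.

Section Points.
Context (L1 L2 : comNzRingType).
Context (i1 : {rmorphism E -> L1}) (i2 : {rmorphism E -> L2}).
Context (Psi1 : GL r L1) (Psi2 : GL r L2).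
Local Notation difference_point := (difference_point i1 i2 Psi1 Psi2).
Local Notation difference_scheme := (difference_scheme i1 i2 Psi1 Psi2).

Lemma quotient_point (R : comNzRingType) (f : {rmorphism E -> R}) (z1 z2 : GL r R) :
  glpoint f z1 (GLker i1 Psi1) -> glpoint f z2 (GLker i2 Psi2) ->
  glpoint (f \o iF) (GLmul (GLinv z1) z2) difference_scheme.
Proof.
move=> Z1 Z2 P P0; have [s [sE sT]] := difference_point_decomposition P.
pose s' := [seq (gleval i1 Psi1 c.1, gleval i2 Psi2 c.2) | c <- s].
rewrite sE.
(* Applying [id ⊗ phi] to the relation in [L1 ⊗_E L2] gives an equation satisfied by [Psi1], hence
   by [z1]. *)
have sum0 phi : functional i2 phi ->
    \sum_(c <- s) gleval f z1 c.1 * f (phi (gleval i2 Psi2 c.2)) = 0.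
  move=> fphi.
  rewrite -[RHS](Z1 (\sum_(c <- s) c.1 * glC E r (phi (gleval i2 Psi2 c.2)))).
    rewrite rmorph_sum; apply: eq_bigr => c _.
    by rewrite (rmorphM (gleval f z1)) gleval_C.
  rewrite GLkerE (rmorph_sum (gleval i1 Psi1)).
  rewrite -[RHS](tens_functional_eq0 (iL := i1) (s := s') fphi).
    rewrite big_map; apply: eq_bigr => c _.
    by rewrite (rmorphM (gleval i1 Psi1)) gleval_C.
  by rewrite big_map -sT.
pose t := [seq gleval i2 Psi2 c.2 | c <- s].
have [phi [fphi _ phiP]] := finite_projector t (subspace0 i2).
pose u := [seq c.2 | c <- s].
(* Expanding [c.2] at [Psi2] along [t] is an equation satisfied by [Psi2], so the same coefficients
   work at [z2]. *)
have zE c : c \in s -> gleval f z2 c.2 =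
    \sum_(l < size t) f (phi l (gleval i2 Psi2 c.2)) * gleval f z2 u`_l.
  move=> cs; apply/eqP; rewrite -subr_eq0; apply/eqP.
  pose q := \sum_(l < size t) glC E r (phi l (gleval i2 Psi2 c.2)) * u`_l.
  rewrite -[RHS](Z2 (c.2 - q)).
    rewrite (rmorphB (gleval f z2)) rmorph_sum; congr (_ - _).
    by apply: eq_bigr => l _; rewrite (rmorphM (gleval f z2)) gleval_C.
  rewrite GLkerE (rmorphB (gleval i2 Psi2)) rmorph_sum -[RHS](phiP (gleval i2 Psi2 c.2)).
    congr (_ - _); apply: eq_bigr => l _; rewrite (rmorphM (gleval i2 Psi2)) gleval_C.
    rewrite -(nth_map 0 0 (gleval i2 Psi2)); first by rewrite -map_comp.
    by apply: leq_trans (ltn_ord l) _; rewrite !size_map.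
  exact: (map_f (fun c => gleval i2 Psi2 c.2)).
transitivity (\sum_(c <- s) \sum_(l < size t) gleval f z1 c.1 *
    f (phi l (gleval i2 Psi2 c.2)) * gleval f z2 u`_l).
  apply: eq_big_seq => c cs; rewrite zE // mulr_sumr.
  by apply: eq_bigr => l _; rewrite mulrA.
by rewrite exchange_big big1 // => l _; rewrite -mulr_suml sum0 ?mul0r.
Qed.

(** Linear disjointness: the map from [L1 ⊗_F F[Γ]] to [L1 ⊗_E L2] is injective, with [F[Γ]] the
    coordinate ring of [difference_scheme]. Elements of the source are tested by functionals of
    [F[Γ]]. *)
Definition constants_disjoint : Prop :=
  forall (s : seq (L1 * GLpoly F r)) (psi : GLpoly F r -> F),
  \sum_(k <- s) tens1 i1 i2 k.1 *
    gleval (tens1 i1 i2 \o (i1 \o iF)) difference_point k.2 = 0 ->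
  functional (glC F r) psi -> (forall P, gl_ideal difference_scheme P -> psi P = 0) ->
  \sum_(k <- s) k.1 * i1 (iF (psi k.2)) = 0.

Lemma translate_point (R : comNzRingType) (f : {rmorphism E -> R}) (z g : GL r R) :
  constants_disjoint -> glpoint f z (GLker i1 Psi1) ->
  glpoint (f \o iF) g difference_scheme -> glpoint f (GLmul z g) (GLker i2 Psi2).
Proof.
move=> disj Z1 Gg P P0.
have [s sE] := GLpoly_decomposition iF P (polynomial_id E r).
rewrite sE.
pose s' := [seq (gleval i1 Psi1 c.1, c.2) | c <- s].
have sum0 psi : functional (glC F r) psi ->
    (forall P, gl_ideal difference_scheme P -> psi P = 0) ->
    \sum_(c <- s) gleval f z c.1 * f (iF (psi c.2)) = 0.
  move=> fpsi kpsi.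
  rewrite -[RHS](Z1 (\sum_(c <- s) c.1 * glC E r (iF (psi c.2)))).
    rewrite rmorph_sum; apply: eq_bigr => c _.
    by rewrite (rmorphM (gleval f z)) gleval_C.
  rewrite GLkerE (rmorph_sum (gleval i1 Psi1)) -[RHS](disj s' psi) //.
    rewrite big_map; apply: eq_bigr => c _.
    by rewrite (rmorphM (gleval i1 Psi1)) gleval_C.
  (* At [z = Psi1] and [g = difference_point] the product is [Psi2], where [P] vanishes. *)
  transitivity (tens2 i1 i2 (gleval i2 Psi2 P)).
    rewrite -gleval_tens2 -(difference_point_mul _ _ Psi1) sE big_map.
    apply: eq_bigr => c _; cbn [fst snd]; rewrite gleval_tens1; congr (_ * _).
  by move: P0; rewrite GLkerE => ->; rewrite rmorph0.
have [phi [fphi kphi phiP]] :=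
  finite_projector [seq c.2 | c <- s]
    (ideal_subspace (glC F r) (gl_ideal_ideal difference_scheme)).
set u := [seq c.2 | c <- s] in phiP.
transitivity (\sum_(c <- s) \sum_(l < size u) gleval f z c.1 *
    f (iF (phi l c.2)) * gleval (f \o iF) g u`_l).
  apply: eq_big_seq => c cs; have /Gg /eqP := phiP _ (map_f snd cs).
  rewrite (rmorphB (gleval (f \o iF) g)) subr_eq0 => /eqP ->.
  rewrite (rmorph_sum (gleval (f \o iF) g)) mulr_sumr.
  by apply: eq_bigr => l _; rewrite (rmorphM (gleval (f \o iF) g)) gleval_C mulrA.
rewrite exchange_big big1 // => l _.
by rewrite -mulr_suml (sum0 _ (fphi l) (kphi l)) mul0r.
Qed.

End Points.
End Cocycle.

(** * The groupoid of torsors *)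

Section GLGroup.
Context (r : nat) (R : comNzRingType).
Implicit Types x y z : GL r R.

Lemma glmulI x (A B : 'M[R]_r) : glmx x *m A = glmx x *m B -> A = B.
Proof.
by move=> AB; rewrite -[A]mul1mx -[B]mul1mx -(glmulVl x) -!mulmxA AB.
Qed.

Lemma GLmulA x y z : GLmul x (GLmul y z) = GLmul (GLmul x y) z.
Proof. by apply: GL_inj; rewrite /= mulmxA. Qed.

Lemma GLmulV x : GLmul x (GLinv x) = GL1 r R.
Proof. by apply: GL_inj; rewrite /= glmulV. Qed.

Lemma GLmulVl x : GLmul (GLinv x) x = GL1 r R.
Proof. by apply: GL_inj; rewrite /= glmulVl. Qed.

Lemma GLmul1 x : GLmul x (GL1 r R) = x.
Proof. by apply: GL_inj; rewrite /= mulmx1. Qed.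

Lemma GLmul1l x : GLmul (GL1 r R) x = x.
Proof. by apply: GL_inj; rewrite /= mul1mx. Qed.

Lemma GLmulKl x y : GLmul (GLinv x) (GLmul x y) = y.
Proof. by rewrite GLmulA GLmulVl GLmul1l. Qed.

Lemma GLmulVKl x y : GLmul x (GLmul (GLinv x) y) = y.
Proof. by rewrite GLmulA GLmulV GLmul1l. Qed.

Lemma GLmulK x y : GLmul (GLmul x y) (GLinv y) = x.
Proof. by rewrite -GLmulA GLmulV GLmul1. Qed.

Lemma GLmulVK x y : GLmul (GLmul x (GLinv y)) y = x.
Proof. by rewrite -GLmulA GLmulVl GLmul1. Qed.

End GLGroup.

Section GLMapMorphism.
Context (r : nat) (R S : comNzRingType) (u : {rmorphism R -> S}).

Lemma GLmapM (x y : GL r R) : GLmap u (GLmul x y) = GLmul (GLmap u x) (GLmap u y).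
Proof. by apply: GL_inj; rewrite /= map_mxM. Qed.

Lemma GLmapV (x : GL r R) : GLmap u (GLinv x) = GLinv (GLmap u x).
Proof. exact: GL_inj. Qed.

Lemma GLmap1 : GLmap u (GL1 r R) = GL1 r S.
Proof. by apply: GL_inj; rewrite /= map_mx1. Qed.

End GLMapMorphism.

Section Points.
Context (k : comNzRingType) (r : nat).

Lemma GLclosed_eq (Z Z' : GLclosed k r) :
  (forall P, gl_ideal Z P <-> gl_ideal Z' P) -> Z = Z'.
Proof.
case: Z => I II Id; case: Z' => J JI Jd /= IJ.
have E : I = J by apply/boolp.funext => P; apply/boolp.propext.
case: J / E JI Jd {IJ} => JI Jd.
by rewrite (boolp.Prop_irrelevance II JI) (boolp.Prop_irrelevance Id Jd).
Qed.

Lemma glpoint_injective (R S : comNzRingType) (f : {rmorphism k -> R})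
    (f' : {rmorphism k -> S}) (u : {rmorphism R -> S}) (g : GL r R) (Z : GLclosed k r) :
  injective u -> (forall c, u (f c) = f' c) ->
  glpoint f g Z <-> glpoint f' (GLmap u g) Z.
Proof.
move=> inju uf; split=> Zg P /Zg P0.
  by rewrite -(@gleval_morph _ _ _ _ u f f' g) // P0 rmorph0.
by apply: inju; rewrite (@gleval_morph _ _ _ _ u f f' g (GLmap u g)) // P0 rmorph0.
Qed.

Lemma glpoint_GLbase (k' R : comNzRingType) (i : {rmorphism k -> k'})
    (f : {rmorphism k' -> R}) (g : GL r R) (Z : GLclosed k r) :
  glpoint f g (GLbase i Z) <-> glpoint (f \o i) g Z.
Proof.
split=> Zg P.
  by move=> ZP; rewrite -gleval_map; apply: Zg; apply: ideal_gen_sub; exists P.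
move/(_ _ (ker_is_ideal (gleval f g))); apply.
by move=> _ [p /Zg p0 ->]; rewrite gleval_map.
Qed.

End Points.

Section Groupoid.
Context (F E : fieldType) (iF : {rmorphism F -> E}) (r : nat) (I : Type).
Context (Z : I -> GLclosed E r) (G : I -> I -> GLclosed F r).
Hypothesis quotientP : forall i j (R : comNzRingType) (f : {rmorphism E -> R}) z z',
  glpoint f z (Z i) -> glpoint f z' (Z j) ->
  glpoint (f \o iF) (GLmul (GLinv z) z') (G i j).
Hypothesis translateP : forall i j (R : comNzRingType) (f : {rmorphism E -> R}) z g,
  glpoint f z (Z i) -> glpoint (f \o iF) g (G i j) -> glpoint f (GLmul z g) (Z j).
Hypothesis Z_nonempty : forall i, fpqc_locally_nonempty (Z i).
Hypothesis G_nonempty : forall i j, fpqc_locally_nonempty (G i j).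

(** If [Z i] has a point over [K], it has one over [R ⊗_F K], and [R] embeds there because [F] is a
    field. *)
Lemma Z_point_extension i (R : comNzRingType) (f : {rmorphism F -> R}) :
  exists (R' : comNzRingType) (f' : {rmorphism E -> R'}) (u : {rmorphism R -> R'})
    (z : GL r R'), [/\ injective u, (forall c, u (f c) = f' (iF c)) & glpoint f' z (Z i)].
Proof.
have [K [fK [z Zz]]] := Z_nonempty i.
pose h := fK \o iF.
exists (tens f h), (tens2 f h \o fK), (tens1 f h), (GLmap (tens2 f h) z).
split; first exact: tens1_inj.
- by move=> c; apply: tens12.
- move=> P /Zz P0.
  by rewrite -(@gleval_morph _ _ _ _ (tens2 f h) fK _ z) // P0 rmorph0.
Qed.

Lemma groupoid1 i (R : comNzRingType) (f : {rmorphism F -> R}) :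
  glpoint f (GL1 r R) (G i i).
Proof.
have [R' [f' [u [z [uI uf Zz]]]]] := Z_point_extension i f.
apply/(glpoint_injective (f' := f' \o iF) _ _ uI uf).
by rewrite GLmap1 -(GLmulVl z); apply: quotientP.
Qed.

(** Given a point [z] of [Z i], translation puts [z g] on [Z j] and [z g h] on [Z k]; then [g h] is
    the quotient of [z g h] by [z]. *)
Lemma groupoidM i j k (R : comNzRingType) (f : {rmorphism F -> R}) g h :
  glpoint f g (G i j) -> glpoint f h (G j k) -> glpoint f (GLmul g h) (G i k).
Proof.
have [R' [f' [u [z [uI uf Zz]]]]] := Z_point_extension i f.
rewrite !(glpoint_injective (f' := f' \o iF) _ _ uI uf) GLmapM => Gg Gh.
have Zzg := translateP Zz Gg; have Zzgh := translateP Zzg Gh.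
by have := quotientP Zz Zzgh; rewrite -GLmulA GLmulKl.
Qed.

Lemma groupoidV i j (R : comNzRingType) (f : {rmorphism F -> R}) g :
  glpoint f g (G i j) -> glpoint f (GLinv g) (G j i).
Proof.
have [R' [f' [u [z [uI uf Zz]]]]] := Z_point_extension i f.
rewrite !(glpoint_injective (f' := f' \o iF) _ _ uI uf) GLmapV => Gg.
have Zzg := translateP Zz Gg.
have := quotientP Zzg Zz.
suff -> : GLmul (GLinv (GLmul z (GLmap u g))) z = GLinv (GLmap u g) by [].
rewrite -[RHS](GLmulKl (GLmul z (GLmap u g))); congr (GLmul _ _).
by rewrite GLmulK.
Qed.

Lemma groupoid_subgroup i : gl_subgroup (G i i).
Proof.
move=> R f; split; first exact: groupoid1.
- by move=> x y; apply: groupoidM.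
- by move=> x; apply: groupoidV.
Qed.

Lemma groupoid_base_stable i : right_stable (Z i) (GLbase iF (G i i)).
Proof. by move=> R f z g Zz /glpoint_GLbase; apply: translateP. Qed.

Lemma groupoid_base_torsor i : right_torsor (Z i) (GLbase iF (G i i)).
Proof.
split=> //; [|exact: groupoid_base_stable|].
  move=> R f; split; rewrite ?glpoint_GLbase; first exact: groupoid1.
  - by move=> x y /glpoint_GLbase Gx /glpoint_GLbase Gy;
      apply/glpoint_GLbase; apply: groupoidM Gx Gy.
  - by move=> x /glpoint_GLbase Gx; apply/glpoint_GLbase; apply: groupoidV.
move=> R f z z' Zz Zz'; exists (GLmul (GLinv z) z'); split.
  by split; [apply/glpoint_GLbase; apply: quotientP|rewrite GLmulVKl].
by move=> g [_ ->]; rewrite GLmulKl.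
Qed.

Lemma groupoid_right_stable i j : right_stable (G i j) (G j j).
Proof. by move=> R f z g; apply: groupoidM. Qed.

Lemma groupoid_left_stable i j : left_stable (G i j) (G i i).
Proof. by move=> R f g z; apply: groupoidM. Qed.

Lemma groupoid_right_torsor i j : right_torsor (G i j) (G j j).
Proof.
split=> //; [exact: groupoid_subgroup|exact: groupoid_right_stable|].
move=> R f z z' Gz Gz'; exists (GLmul (GLinv z) z'); split.
  by rewrite GLmulVKl; split=> //; apply: groupoidM Gz'; apply: groupoidV.
by move=> g [_ ->]; rewrite GLmulKl.
Qed.

Lemma groupoid_left_torsor i j : left_torsor (G i j) (G i i).
Proof.
split=> //; [exact: groupoid_subgroup|exact: groupoid_left_stable|].
move=> R f z z' Gz Gz'; exists (GLmul z' (GLinv z)); split.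
  by rewrite GLmulVK; split=> //; apply: groupoidM Gz' _; apply: groupoidV.
by move=> g [_ ->]; rewrite GLmulK.
Qed.

End Groupoid.

(** * Difference schemes under semilinear maps *)

Section Functoriality.
Context (F E : fieldType) (iF : {rmorphism F -> E}) (r : nat).
Context (s : {rmorphism E -> E}) (Phi : GL r E).
Hypothesis s_fixed : forall c, s (iF c) = iF c.

(** The equation [σ(Ψ) = ΦΨ] for a map between two algebras with their own solutions. It covers [σ],
    its powers, the maps they induce on factors, and projections with [Phi = 1]. *)
Definition frobenius (L L' : comNzRingType) (i : {rmorphism E -> L})
    (i' : {rmorphism E -> L'}) (Psi : GL r L) (Psi' : GL r L')
    (t : {rmorphism L -> L'}) : Prop :=
  (forall e, t (i e) = i' (s e)) /\ map_mx t Psi = map_mx i' Phi *m Psi'.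

(** The map is [t1 ⊗ t2]. It produces [(Φ Psi1')^-1 ⊗ Φ Psi2'], where [Φ] cancels because its
    entries lie in [E] and cross the tensor sign. *)
Lemma difference_point_functorial (L1 L2 L1' L2' : comNzRingType)
    (i1 : {rmorphism E -> L1}) (i2 : {rmorphism E -> L2})
    (i1' : {rmorphism E -> L1'}) (i2' : {rmorphism E -> L2'})
    (Psi1 : GL r L1) (Psi2 : GL r L2) (Psi1' : GL r L1') (Psi2' : GL r L2')
    (t1 : {rmorphism L1 -> L1'}) (t2 : {rmorphism L2 -> L2'}) :
  frobenius i1 i1' Psi1 Psi1' t1 -> frobenius i2 i2' Psi2 Psi2' t2 ->
  exists w : {rmorphism tens i1 i2 -> tens i1' i2'},
    (forall x, w (tens1 i1 i2 x) = tens1 i1' i2' (t1 x)) /\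
    forall P, w (gleval (tens1 i1 i2 \o (i1 \o iF))
        (difference_point i1 i2 Psi1 Psi2) P) =
      gleval (tens1 i1' i2' \o (i1' \o iF)) (difference_point i1' i2' Psi1' Psi2') P.
Proof.
move=> [t1s t1P] [t2s t2P].
have tE e : (tens1 i1' i2' \o t1) (i1 e) = (tens2 i1' i2' \o t2) (i2 e).
  by rewrite /= t1s t2s tens12.
pose w : {rmorphism tens i1 i2 -> tens i1' i2'} := tens_lift tE.
have w1 x : w (tens1 i1 i2 x) = tens1 i1' i2' (t1 x) by exact: tens_lift1.
have w2 x : w (tens2 i1 i2 x) = tens2 i1' i2' (t2 x) by exact: tens_lift2.
have wP : map_mx w (difference_point i1 i2 Psi1 Psi2) =
    difference_point i1' i2' Psi1' Psi2'.
  have mul L L' i i' P P' :=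
    congr1 (@glmx r _) (@difference_point_mul _ r L L' i i' P P').
  (* Multiplying on the left by the image of [Φ Psi1'] avoids handling inverses. *)
  apply: (@glmulI _ _ (GLmap (tens1 i1' i2') (GLmul (GLmap i1' Phi) Psi1'))).
  have {1}-> : glmx (GLmap (tens1 i1' i2') (GLmul (GLmap i1' Phi) Psi1')) =
      map_mx w (GLmap (tens1 i1 i2) Psi1).
    rewrite /= -t1P -!map_mx_comp; apply/matrixP => a b; rewrite !mxE /=.
    by rewrite w1.
  rewrite -map_mxM [X in map_mx w X]mul GLmapM /= -mulmxA [X in _ *m X]mul.
  transitivity (map_mx (tens2 i1' i2') (map_mx i2' Phi *m Psi2')).
    by rewrite -t2P -!map_mx_comp; apply/matrixP => a b; rewrite !mxE /= w2.
  rewrite map_mxM; congr (_ *m _); rewrite -!map_mx_comp.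
  by apply/matrixP => a b; rewrite !mxE /= tens12.
exists w; split=> // P; apply: gleval_morph => // c.
by rewrite [LHS]w1 /= t1s s_fixed.
Qed.

Lemma frobenius_difference (L1 L2 L1' L2' : comNzRingType)
    (i1 : {rmorphism E -> L1}) (i2 : {rmorphism E -> L2})
    (i1' : {rmorphism E -> L1'}) (i2' : {rmorphism E -> L2'})
    (Psi1 : GL r L1) (Psi2 : GL r L2) (Psi1' : GL r L1') (Psi2' : GL r L2')
    (t1 : {rmorphism L1 -> L1'}) (t2 : {rmorphism L2 -> L2'}) :
  frobenius i1 i1' Psi1 Psi1' t1 -> frobenius i2 i2' Psi2 Psi2' t2 ->
  forall P, gl_ideal (difference_scheme iF i1 i2 Psi1 Psi2) P ->
    gl_ideal (difference_scheme iF i1' i2' Psi1' Psi2') P.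
Proof.
move=> t1P t2P P; have [w [_ wP]] := difference_point_functorial t1P t2P.
by rewrite !GLkerE -wP => ->; rewrite rmorph0.
Qed.

(** Source and target solutions coincide here, so [t1 ⊗ t2] fixes the coordinates of the difference
    point, and Artin's argument applies with [t1] as [tau]. *)
Lemma frobenius_disjoint (K : fieldType) (L2 : comNzRingType)
    (i1 : {rmorphism E -> K}) (i2 : {rmorphism E -> L2})
    (Psi1 : GL r K) (Psi2 : GL r L2)
    (t1 : {rmorphism K -> K}) (t2 : {rmorphism L2 -> L2}) :
  frobenius i1 i1 Psi1 Psi1 t1 -> frobenius i2 i2 Psi2 Psi2 t2 ->
  (forall x, t1 x = x -> exists c, x = i1 (iF c)) ->
  constants_disjoint iF i1 i2 Psi1 Psi2.
Proof.
move=> t1P t2P t1_fixed a psi sum0 fpsi kpsi.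
have [w [w1 wP]] := difference_point_functorial t1P t2P.
apply: (@invariants_disjoint _ _ (i1 \o iF) t1 _ (tens1 i1 i2) w _ (glC F r)
  (gleval (tens1 i1 i2 \o (i1 \o iF)) (difference_point i1 i2 Psi1 Psi2)))
  sum0 fpsi kpsi => //.
- move=> x; split=> [/t1_fixed //|[c ->]].
  by case: t1P => /= t1s _; rewrite t1s s_fixed.
- by move=> c; apply: gleval_C.
Qed.

End Functoriality.

(** * The powers of [σ] *)

Lemma rmorph_pack (A B : comNzRingType) (g : A -> B) :
  {morph g : x y / x - y} -> g 1 = 1 -> {morph g : x y / x * y} ->
  exists h : {rmorphism A -> B}, h =1 g.
Proof.
move=> gB g1 gM.
pose gZ := GRing.isZmodMorphism.Build A B g gB.
pose gm := GRing.isMonoidMorphism.Build A B g (conj g1 gM).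
pose h : {rmorphism A -> B} := HB.pack g gZ gm.
by exists h.
Qed.

Lemma rmorph_factor (A B C : comNzRingType) (p : {rmorphism A -> B})
    (f : {rmorphism A -> C}) :
  (forall b, exists a, p a = b) -> (forall a, p a = 0 -> f a = 0) ->
  exists g : {rmorphism B -> C}, forall a, g (p a) = f a.
Proof.
move=> /boolp.choice[q qP] pf.
have gE a : f (q (p a)) = f a.
  by apply/eqP; rewrite -subr_eq0 -rmorphB pf // rmorphB qP subrr.
have [|||g gP] := @rmorph_pack B C (fun b => f (q b)).
- by move=> x y; rewrite -rmorphB -[in LHS](qP x) -[in LHS](qP y) -rmorphB gE.
- by rewrite -(rmorph1 p) gE rmorph1.
- by move=> x y; rewrite -rmorphM -[in LHS](qP x) -[in LHS](qP y) -rmorphM gE.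
by exists g => a; rewrite gP gE.
Qed.

Lemma rmorph_restrict (A B C : comNzRingType) (i : {rmorphism B -> C})
    (f : {rmorphism A -> C}) : injective i ->
  (forall a, exists b, f a = i b) ->
  exists g : {rmorphism A -> B}, forall a, f a = i (g a).
Proof.
move=> iI /boolp.choice[q qP].
have [|||g gP] := @rmorph_pack A B q.
- by move=> x y; apply: iI; rewrite -qP !rmorphB !qP.
- by apply: iI; rewrite -qP !rmorph1.
- by move=> x y; apply: iI; rewrite -qP !rmorphM !qP.
by exists g => a; rewrite gP.
Qed.

Lemma iter_rmorph (A : comNzRingType) (f : {rmorphism A -> A}) (n : nat) :
  exists g : {rmorphism A -> A}, g =1 iter n f.
Proof.
elim: n => [|n [g gE]]; first by exists idfun.
by exists (f \o g) => x /=; rewrite gE.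
Qed.

Lemma val_iter_ordS (d n : nat) (l : 'I_d) : (iter n (@ordS d) l = (l + n) %% d :> nat)%N.
Proof.
elim: n => [|n IHn]; first by rewrite addn0 modn_small.
by rewrite iterS /= IHn -addn1 modnDml addn1 addnS.
Qed.

Lemma iter_ordS_period (d : nat) (l : 'I_d) : iter d (@ordS d) l = l.
Proof.
by apply: val_inj; rewrite /= val_iter_ordS modnDr modn_small.
Qed.

Lemma iter_ordS_neq (d n : nat) (l : 'I_d) : (0 < n < d)%N -> iter n (@ordS d) l != l.
Proof.
move=> /andP[n0 nd]; rewrite -val_eqE /= val_iter_ordS.
rewrite -[X in _ != X](modn_small (ltn_ord l)) -{2}[val l]addn0.
by rewrite eqn_modDl mod0n modn_small // -lt0n.
Qed.

Lemma iter_ordS_reach (d : nat) (l m : 'I_d) : exists n, iter n (@ordS d) l = m.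
Proof.
exists (d - l + m)%N; apply: val_inj; rewrite /= val_iter_ordS.
by rewrite addnA subnKC ?modnDl ?modn_small // ltnW.
Qed.

Section SigmaTriple.
Context (T : sigma_triple).
Local Notation iF := (st_iF T).
Local Notation iE := (st_iE T).
Local Notation pr l := (@st_pr T l).
Local Notation d := (st_d T).
Local Notation sigma := (st_sigma T).
Local Notation S := (@ordS d).
Local Notation L := (st_L T).

Definition concentrated (l : 'I_d) (x : L) : Prop :=
  forall m, m != l -> pr m x = 0.

Lemma pr_inj (x y : L) : (forall l, pr l x = pr l y) -> x = y.
Proof.
move=> xy; have [z [_ zU]] := st_prod (fun l => pr l y).
by rewrite -(zU x) // -(zU y).
Qed.

Lemma pr_concentrated l (x : st_Lf l) : exists2 y, pr l y = x & concentrated l y.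
Proof.
have [y [yP _]] := st_prod (dfwith (fun m => 0 : st_Lf m) x).
exists y; first by rewrite yP dfwith_in.
by move=> m ml; rewrite yP dfwith_out // eq_sym.
Qed.

Lemma pr_surj l (x : st_Lf l) : exists y, pr l y = x.
Proof. by have [y] := pr_concentrated x; exists y. Qed.

(** [st_sigmaL] concerns single factors, so [x] is split into its components: the [l]-th is zero,
    and the others land in factors different from [S l] because [S] is injective. *)
Lemma sigma_pr0 l x : pr l x = 0 -> pr (S l) (sigma x) = 0.
Proof.
move=> x0.
have /boolp.choice[y yP] (m : 'I_d) : exists y, pr m y = pr m x /\ concentrated m y.
  by have [y] := pr_concentrated (pr m x); exists y.
have -> : x = \sum_m y m.
  apply: pr_inj => m; rewrite rmorph_sum (bigD1 m) //= big1 => [|k km].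
    by rewrite addr0; have [] := yP m.
  by have [_ ->] := yP k; rewrite // eq_sym.
rewrite !rmorph_sum big1 // => m _; have [ymx ymC] := yP m.
have [ml|ml] := eqVneq m l; last first.
  by apply: (st_sigmaL ymC); rewrite (inj_eq (@ordS_inj _)) eq_sym.
suff -> : y m = 0 by rewrite !rmorph0.
apply: pr_inj => k; rewrite rmorph0.
by have [->|/ymC //] := eqVneq k m; rewrite ymx ml.
Qed.

Lemma iter_sigma_pr0 n l x : pr l x = 0 -> pr (iter n S l) (iter n sigma x) = 0.
Proof. by move=> x0; elim: n => //= n; apply: sigma_pr0. Qed.

Lemma iter_sigma_concentrated n l x :
  concentrated l x -> concentrated (iter n S l) (iter n sigma x).
Proof. by move=> xl; elim: n => //= n IHn; apply: st_sigmaL. Qed.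

Lemma iter_sigma_period l x :
  pr l x = 0 -> pr l (iter d sigma x) = 0.
Proof. by move=> /(iter_sigma_pr0 d); rewrite iter_ordS_period. Qed.

(** Lift the component to an element [y] of the factor [L_l]. The sum of [σ^t(y)] over one period is
    fixed by [σ], hence lies in [F], and its [l]-th component is that of [y]. *)
Lemma period_fixed l x : pr l (iter d sigma x) = pr l x ->
  exists c, pr l x = pr l (iE (iF c)).
Proof.
move=> xfix; have [y yx yC] := pr_concentrated (pr l x).
have yfix : iter d sigma y = y.
  apply: pr_inj => m; have [->|ml] := eqVneq m l; last first.
    rewrite [RHS]yC //; have := @iter_sigma_concentrated d _ _ yC.
    by rewrite iter_ordS_period; apply.
  have [g gE] := iter_rmorph sigma d.
  apply/eqP; rewrite yx -xfix -!gE -subr_eq0 -!rmorphB /= gE.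
  by apply/eqP/iter_sigma_period; rewrite rmorphB yx subrr.
pose w := \sum_(t < d) iter t sigma y.
have /st_fixL [c wE] : sigma w = w.
  apply/eqP; rewrite -subr_eq0 rmorph_sum -sumrB.
  rewrite -(big_mkord predT (fun t => sigma (iter t sigma y) - iter t sigma y)).
  by rewrite (telescope_sumr (fun t => iter t sigma y)) // yfix subrr.
exists c; rewrite -wE rmorph_sum; have d0 := st_d_gt0 T.
(* Only [t = 0] contributes: for [0 < t < d] the element [σ^t(y)] sits in another factor. *)
rewrite (bigD1 (Ordinal d0)) //= yx big1 ?addr0 // => t t0.
apply: (@iter_sigma_concentrated t _ _ yC); rewrite eq_sym; apply: iter_ordS_neq.
by rewrite ltn_ord andbT lt0n.
Qed.

Lemma shift_exists l : exists u : {rmorphism st_Lf l -> st_Lf (S l)},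
  forall x, u (pr l x) = pr (S l) (sigma x).
Proof.
by apply: (@rmorph_factor _ _ _ (pr l) (pr (S l) \o sigma));
  [exact: pr_surj|exact: sigma_pr0].
Qed.

Lemma period_exists l (t : {rmorphism L -> L}) : t =1 iter d sigma ->
  exists u : {rmorphism st_Lf l -> st_Lf l}, forall x, u (pr l x) = pr l (t x).
Proof.
move=> tE; apply: (@rmorph_factor _ _ _ (pr l) (pr l \o t)); first exact: pr_surj.
by move=> x /=; rewrite tE; apply: iter_sigma_period.
Qed.

Section Frobenius.
Context (r : nat) (Phi : GL r (st_E T)) (Psi : GL r L).
Hypothesis hPsi : map_mx sigma Psi = map_mx iE Phi *m Psi.

Lemma sigma_frobenius : exists s : {rmorphism st_E T -> st_E T},
  (forall c, s (iF c) = iF c) /\ frobenius s Phi iE iE Psi Psi sigma.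
Proof.
have iEI : injective iE := @fmorph_inj _ _ iE.
have [s sE] := rmorph_restrict (f := sigma \o iE) iEI (@st_sigmaE T).
exists s; split; last by split.
move=> c; apply: iEI; rewrite -[LHS]sE /=.
by apply/st_fixE; exists c.
Qed.

Lemma iter_frobenius n : exists (s : {rmorphism st_E T -> st_E T})
    (Phi' : GL r (st_E T)) (t : {rmorphism L -> L}),
  [/\ t =1 iter n sigma, (forall c, s (iF c) = iF c) &
      frobenius s Phi' iE iE Psi Psi t].
Proof.
have [s [sF [sE sPsi]]] := sigma_frobenius.
elim: n => [|n [s' [Phi' [t [tE s'F [s'E s'Psi]]]]]].
  exists idfun, (GL1 r _), idfun; split=> //; split=> //.
  by rewrite /= map_mx1 mul1mx; apply/matrixP => a b; rewrite mxE.
(* The new matrix comes from [σ(Φ'Ψ) = s(Φ')ΦΨ]. *)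
exists (s \o s'), (GLmul (GLmap s Phi') Phi), (sigma \o t); split.
- by move=> x /=; rewrite tE.
- by move=> c /=; rewrite s'F sF.
split=> [e|]; first by rewrite /= s'E sE.
rewrite (map_mx_comp t sigma) s'Psi map_mxM hPsi /= map_mxM mulmxA.
by congr (_ *m _ *m _); apply/matrixP => a b; rewrite !mxE sE.
Qed.

Lemma frobenius_pr l l' (s : {rmorphism st_E T -> st_E T})
    (Phi' : GL r (st_E T)) (t : {rmorphism L -> L})
    (u : {rmorphism st_Lf l -> st_Lf l'}) :
  frobenius s Phi' iE iE Psi Psi t -> (forall x, u (pr l x) = pr l' (t x)) ->
  frobenius s Phi' (pr l \o iE) (pr l' \o iE) (GLmap (pr l) Psi) (GLmap (pr l') Psi) u.
Proof.
move=> [tE tPsi] uE; split=> [e|]; first by rewrite /= uE tE.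
transitivity (map_mx (pr l') (map_mx t Psi)).
  by apply/matrixP => a b; rewrite !mxE uE.
by rewrite tPsi map_mxM -map_mx_comp.
Qed.

End Frobenius.
End SigmaTriple.

(** * Galois groups and torsors *)

Section Galois.
Context (T : sigma_triple) (r : nat) (Phi : GL r (st_E T)) (Psi : GL r (st_L T)).
Hypothesis hPsi : map_mx (st_sigma T) Psi = map_mx (st_iE T) Phi *m Psi.
Local Notation iF := (st_iF T).
Local Notation iE := (st_iE T).
Local Notation pr l := (@st_pr T l).
Local Notation S := (@ordS (st_d T)).

(** An intermediary between [galG] and the components: Artin's argument needs a field on the left,
    so only that side is projected. *)
Definition mixed_scheme l : GLclosed (st_F T) r :=
  difference_scheme iF (pr l \o iE) iE (GLmap (pr l) Psi) Psi.
Definition component_scheme l m : GLclosed (st_F T) r :=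
  difference_scheme iF (pr l \o iE) (pr m \o iE) (GLmap (pr l) Psi) (GLmap (pr m) Psi).

Lemma frobenius_id (L : comNzRingType) (i : {rmorphism st_E T -> L}) (P : GL r L) :
  frobenius idfun (GL1 r _) i i P P idfun.
Proof.
by split=> //; rewrite /= map_mx1 mul1mx; apply/matrixP => a b; rewrite mxE.
Qed.

Lemma frobenius_proj l :
  frobenius idfun (GL1 r _) iE (pr l \o iE) Psi (GLmap (pr l) Psi) (pr l).
Proof. by split=> //; rewrite /= map_mx1 mul1mx. Qed.

Lemma mixed_shift l P : gl_ideal (mixed_scheme l) P -> gl_ideal (mixed_scheme (S l)) P.
Proof.
have [s [sF sfrob]] := sigma_frobenius hPsi; have [u uE] := shift_exists l.
exact: (frobenius_difference sF (frobenius_pr sfrob uE) sfrob).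
Qed.

Lemma component_shift l P :
  gl_ideal (component_scheme l l) P -> gl_ideal (component_scheme (S l) (S l)) P.
Proof.
have [s [sF sfrob]] := sigma_frobenius hPsi; have [u uE] := shift_exists l.
have ufrob := frobenius_pr sfrob uE.
exact: (frobenius_difference sF ufrob ufrob).
Qed.

(** Shifts reach every index from every other one, so inclusions in both directions follow. *)
Lemma component_diag l m : component_scheme l l = component_scheme m m.
Proof.
have sub l' m' P :
    gl_ideal (component_scheme l' l') P -> gl_ideal (component_scheme m' m') P.
  have [n <-] := iter_ordS_reach l' m'.
  by elim: n => //= n IHn /IHn; apply: component_shift.
by apply: GLclosed_eq => P; split; apply: sub.
Qed.

(** Vanishing in one [L_l ⊗_E L] spreads to all of them by shifting. Functionals of the right factor
    then give elements of [L] with all components zero. *)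
Lemma mixed_subgalG l P : gl_ideal (mixed_scheme l) P -> gl_ideal (galG Psi) P.
Proof.
move=> Pl; have {l Pl} Pm m : gl_ideal (mixed_scheme m) P.
  have [n <-] := iter_ordS_reach l m.
  by elim: n => //= n; apply: mixed_shift.
have [s [_ sE]] := difference_point_decomposition iF P.
rewrite GLkerE sE.
pose s' := [seq (gleval iE Psi c.1, gleval iE Psi c.2) | c <- s].
suff: \sum_(c <- s') tens1 iE iE c.1 * tens2 iE iE c.2 = 0 by rewrite big_map.
apply: tens_eq0 => phi fphi; apply: pr_inj => m.
pose s'' := [seq (gleval (pr m \o iE) (GLmap (pr m) Psi) c.1,
  gleval iE Psi c.2) | c <- s].
have := Pm m; rewrite GLkerE sE => sum0.
rewrite big_map rmorph0 rmorph_sum.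
rewrite -[RHS](@tens_functional_eq0 _ _ _ (pr m \o iE) iE s'' phi fphi); last first.
  by rewrite big_map.
rewrite big_map; apply: eq_bigr => c _; cbn [fst snd].
by rewrite rmorphM; congr (_ * _); apply: gleval_morph.
Qed.

Lemma period_frobenius : exists (s : {rmorphism st_E T -> st_E T})
    (Phi' : GL r (st_E T)) (t : {rmorphism st_L T -> st_L T})
    (u : forall l, {rmorphism st_Lf l -> st_Lf l}),
  [/\ forall c, s (iF c) = iF c, frobenius s Phi' iE iE Psi Psi t,
      forall l, frobenius s Phi' (pr l \o iE) (pr l \o iE)
        (GLmap (pr l) Psi) (GLmap (pr l) Psi) (u l) &
      forall l x, u l x = x -> exists c, x = pr l (iE (iF c))].
Proof.
have [s [Phi' [t [tE sF tfrob]]]] := iter_frobenius hPsi (st_d T).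
have u_ex l := boolp.cid (period_exists l tE).
exists s, Phi', t, (fun l => sval (u_ex l)); split=> // l.
  by case: (u_ex l) => u uE /=; exact: (frobenius_pr tfrob uE).
case: (u_ex l) => u uE /= x; have [y <-] := pr_surj x.
by rewrite uE tE; apply: period_fixed.
Qed.

Lemma component_disjoint l m : constants_disjoint iF (pr l \o iE) (pr m \o iE)
  (GLmap (pr l) Psi) (GLmap (pr m) Psi).
Proof.
have [s [Phi' [t [u [sF tfrob ufrob ufix]]]]] := period_frobenius.
exact: (frobenius_disjoint sF (ufrob l) (ufrob m) (ufix l)).
Qed.

Lemma mixed_disjoint l :
  constants_disjoint iF (pr l \o iE) iE (GLmap (pr l) Psi) Psi.
Proof.
have [s [Phi' [t [u [sF tfrob ufrob ufix]]]]] := period_frobenius.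
exact: (frobenius_disjoint sF (ufrob l) tfrob (ufix l)).
Qed.

(** The relation is projected by [pr l ⊗ id] to each [L_l ⊗_E L]. The functional still applies there
    because the mixed ideal lies in that of [galG]. *)
Lemma galG_disjoint : constants_disjoint iF iE iE Psi Psi.
Proof.
move=> s psi sum0 fpsi kpsi; apply: pr_inj => l.
have [w [w1 wP]] := difference_point_functorial (iF := iF) (s := idfun)
  (fun c => erefl) (frobenius_proj l) (frobenius_id iE Psi).
pose s' := [seq (pr l k.1, k.2) | k <- s].
rewrite rmorph0 rmorph_sum -[RHS](@mixed_disjoint l s' psi) //.
- by rewrite big_map; apply: eq_bigr => k _; rewrite rmorphM.
- rewrite big_map -[RHS](rmorph0 w) -[in RHS]sum0 rmorph_sum.
  by apply: eq_bigr => k _; rewrite rmorphM wP w1.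
- by move=> P /mixed_subgalG; apply: kpsi.
Qed.

Lemma PsiTlmE l m :
  PsiTlm Psi l m = difference_point (pr l \o iE) (pr m \o iE)
    (GLmap (pr l) Psi) (GLmap (pr m) Psi).
Proof.
apply: GL_inj; rewrite /= map_mxM -!map_mx_comp; congr (_ *m _).
  by apply/matrixP => a b; rewrite !mxE /= [LHS]tens_lift1.
by apply/matrixP => a b; rewrite !mxE /= [LHS]tens_lift2.
Qed.

Lemma galGmE m : galGm Psi m = component_scheme (index0 T) m.
Proof. by apply: GLclosed_eq => P; rewrite /galGm PsiTlmE. Qed.

End Galois.

Theorem theorem4p13 (T : sigma_triple) (r : nat)
    (Phi : GL r (st_E T)) (Psi : GL r (st_L T))
    (hPsi : map_mx (st_sigma T) Psi = map_mx (st_iE T) Phi *m Psi) :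
  [/\ [/\ gl_subgroup (galG Psi),
          right_stable (galZ Psi) (GLbase (st_iF T) (galG Psi)) &
          right_torsor (galZ Psi) (GLbase (st_iF T) (galG Psi))],
      gl_subgroup (galGm Psi (index0 T)) /\
      (forall l : 'I_(st_d T),
          right_stable (galZl Psi l)
            (GLbase (st_iF T) (galGm Psi (index0 T))) /\
          right_torsor (galZl Psi l)
            (GLbase (st_iF T) (galGm Psi (index0 T)))) &
      forall m : 'I_(st_d T),
        [/\ right_stable (galGm Psi m) (galGm Psi (index0 T)),
            left_stable (galGm Psi m) (galGm Psi (index0 T)),
            right_torsor (galGm Psi m) (galGm Psi (index0 T)) &
            left_torsor (galGm Psi m) (galGm Psi (index0 T))]].
Proof.
have nonempty (k : fieldType) (R : comNzRingType) (f : {rmorphism k -> R}) (g : GL r R) :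
    fpqc_locally_nonempty (GLker f g) by exists R, f, g.
have quot i j (R : comNzRingType) (f : {rmorphism st_E T -> R}) z z' :
    glpoint f z (galZl Psi i) -> glpoint f z' (galZl Psi j) ->
    glpoint (f \o st_iF T) (GLmul (GLinv z) z') (component_scheme Psi i j).
  exact: quotient_point.
have trans i j (R : comNzRingType) (f : {rmorphism st_E T -> R}) z g :
    glpoint f z (galZl Psi i) -> glpoint (f \o st_iF T) g (component_scheme Psi i j) ->
    glpoint f (GLmul z g) (galZl Psi j).
  by apply: translate_point; apply: component_disjoint hPsi _ _.
have Zn i : fpqc_locally_nonempty (galZl Psi i) by apply: nonempty.
have Gn i j : fpqc_locally_nonempty (component_scheme Psi i j) by apply: nonempty.
split.
(* The first assertion is the groupoid with a single object. *)
- pose Z (_ : unit) := galZ Psi; pose G (_ _ : unit) := galG Psi.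
  have quotL i j (R : comNzRingType) (f : {rmorphism st_E T -> R}) z z' :
      glpoint f z (Z i) -> glpoint f z' (Z j) ->
      glpoint (f \o st_iF T) (GLmul (GLinv z) z') (G i j).
    exact: quotient_point.
  have transL i j (R : comNzRingType) (f : {rmorphism st_E T -> R}) z g :
      glpoint f z (Z i) -> glpoint (f \o st_iF T) g (G i j) ->
      glpoint f (GLmul z g) (Z j).
    by apply: translate_point; apply: galG_disjoint hPsi.
  have ZnL i : fpqc_locally_nonempty (Z i) by apply: nonempty.
  split; [exact: (groupoid_subgroup quotL transL ZnL tt)
    |exact: (groupoid_base_stable transL (i := tt))
    |exact: (groupoid_base_torsor quotL transL ZnL tt)].
- rewrite galGmE; split=> [|l]; first exact: (groupoid_subgroup quot trans Zn _).
  (* The group attached to the object [Z_l] is [Γ_ll], which equals [Γ_00]. *)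
  rewrite (component_diag hPsi (index0 T) l); split.
    exact: (groupoid_base_stable trans (i := l)).
  exact: (groupoid_base_torsor quot trans Zn l).
- move=> m; rewrite !galGmE; split.
  (* On the right of [Γ_0m] it is [Γ_mm] that acts; on the left it is [Γ_00] itself. *)
  + rewrite (component_diag hPsi (index0 T) m).
    exact: (groupoid_right_stable quot trans Zn (i := index0 T) (j := m)).
  + exact: (groupoid_left_stable quot trans Zn (i := index0 T) (j := m)).
  + rewrite (component_diag hPsi (index0 T) m).
    exact: (groupoid_right_torsor quot trans Zn Gn (index0 T) m).
  + exact: (groupoid_left_torsor quot trans Zn Gn (index0 T) m).
Qed.
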